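(* Let $r\in\mathbb{N}$. For each $j\in\{1,\ldots,r\}$ let $\Gamma_j\subset \mathrm{PSL}_2(\mathbb{R})$ be a Fuchsian Schottky group with a fixed choice of Schottky data (disks, side-pairings, geodesic sides $s_{j,k}$ and forward intervals $I_{j,k}$, $k\in\mathcal{I}_j$, as described in the context). Let $G=\mathrm{PSL}_2(\mathbb{R})^r$, $\Gamma=\Gamma_1\times\cdots\times\Gamma_r$, $\mathbb{X}=\mathbb{H}^r$ and $\mathbb{Y}=\Gamma\backslash\mathbb{X}$. For $m=(m_1,\ldots,m_r)\in\mathcal{J}=\prod_{j=1}^r\mathcal{I}_j$ set $$C_m=\{(g_1,\ldots,g_r)\in G \mid g_j(i)\in s_{j,m_j}\text{ and } g_j(\infty)\in I_{j,m_j}\text{ for all } j\in\{1,\ldots,r\}\},$$ and set $C=\bigcup_{m\in\mathcal{J}}C_m$ and $\widehat{C}=\pi^\Gamma(C)\subseteq\Gamma\backslash G$, where $\pi^\Gamma\colon G\to\Gamma\backslash G$ is the quotient map. Then $\widehat{C}$ is a cross section for the Weyl chamber flow on $\mathbb{Y}$, and $C$ is a set of representatives for $\widehat{C}$.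
   Context: Schottky data. $\mathbb{H}=\{z\in\mathbb{C}\mid \operatorname{Im} z>0\}$ is the hyperbolic plane, on which $\mathrm{PSL}_2(\mathbb{R})$ acts by fractional linear transformations; the action extends to $P^1_{\mathbb{R}}=\mathbb{R}\cup\{\infty\}$. A (Fuchsian) Schottky group arises as follows. For $q\in\mathbb{N}$ choose $2q$ pairwise disjoint closed Euclidean disks $\mathcal{D}_1,\mathcal{D}_{-1},\ldots,\mathcal{D}_q,\mathcal{D}_{-q}$ in $\mathbb{C}$ (of positive radius) centered in $\mathbb{R}$. For $k\in\{1,\ldots,q\}$ pick $g_k\in\mathrm{PSL}_2(\mathbb{R})$ mapping the exterior of $\mathcal{D}_k$ (in the Riemann sphere) onto the interior of $\mathcal{D}_{-k}$, and set $g_{-k}=g_k^{-1}$. The Schottky group is $\langle g_1,\ldots,g_q\rangle$. Put $\mathcal{I}=\{\pm1,\ldots,\pm q\}$. For $k\in\mathcal{I}$ let $s_k$ be the boundary of $\mathcal{D}_k$ in $\mathbb{H}$ (a geodesic) and let the forward interval $I_k=P^1_{\mathbb{R}}\setminus\mathcal{D}_k$ be the part of $P^1_{\mathbb{R}}$ exterior to $\mathcal{D}_k$. For the group $\Gamma_j$ all these objects carry an additional index $j$: $q_j,\ \mathcal{I}_j,\ \mathcal{D}_{j,k},\ g_{j,k},\ s_{j,k},\ I_{j,k}$. Weyl chamber flow. $G=\mathrm{PSL}_2(\mathbb{R})^r$ acts componentwise on $\mathbb{X}=\mathbb{H}^r$. With origin $(i,\ldots,i)$ let $K=\mathrm{PSO}(2)^r$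 be its stabilizer, so $\mathbb{X}=G/K$ and $\mathbb{Y}=\Gamma\backslash G/K$. For $t\in\mathbb{R}$ let $a_t\in\mathrm{PSL}_2(\mathbb{R})$ be the class of $\mathrm{diag}(e^{t/2},e^{-t/2})$, and let $A=\{(a_{t_1},\ldots,a_{t_r})\mid t_j\in\mathbb{R}\}$. The centralizer $M$ of $A$ in $K$ is trivial, so the Weyl chambers of $\mathbb{X}$ are identified with $G/M=G$ and the Weyl chambers of $\mathbb{Y}$ with $\Gamma\backslash G$. The Weyl chamber flow on $\mathbb{Y}$ is the action $(a,\Gamma g)\mapsto\Gamma ga$ of $A$ on $\Gamma\backslash G$. The oriented flats of $\mathbb{Y}$ are the elements $\Gamma gA$ of $\Gamma\backslash G/A$; the underlying flat of $\Gamma gA$ is the subset $\Gamma gAK$ of $\mathbb{Y}$, and the oriented flat is called compact if this subset of $\mathbb{Y}$ is compact. The set of regular elements of $A$ (the union of the Weyl group translates of the positive Weyl chamber $A^+=\{(a_{t_1},\ldots,a_{t_r})\mid t_j>0\ \forall j\}$) is $A^{\mathrm{reg}}=\{(a_{t_1},\ldots,a_{t_r})\mid t_j\neq0\ \forall j\}$. Cross sections. For $\widehat{S}\subseteq\Gamma\backslash G$, an oriented flat $\Gamma gA$ intersects $\widehat{S}$ in $\Gamma h\in\widehat{S}$ if $\Gamma hA=\Gamma gA$. The intersection is discrete if there is a neighborhood $U$ of the identity in $A$ such that $\Gamma ha\notin\widehat{S}$ for all $a\in U\cap A^{\mathrm{reg}}$. A subset $\widehat{C}\subseteq\Gamma\backslash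 G$ is a cross section for the Weyl chamber flow on $\mathbb{Y}$ if (C1) every compact oriented flat of $\mathbb{Y}$ intersects $\widehat{C}$, and (C2) each intersection of any oriented flat of $\mathbb{Y}$ with $\widehat{C}$ is discrete. A set $C\subseteq G$ is a set of representatives for $\widehat{C}$ if $\pi^\Gamma$ restricts to a bijection from $C$ onto $\widehat{C}$. *)

(* Defs.v *)
From HB Require Import structures.
From mathcomp Require Import all_boot all_order all_algebra ring.
From mathcomp Require Import generic_quotient complex.
From mathcomp Require Import boolp classical_sets functions reals.
From mathcomp Require Import topology normedtype sequences exp.

Set Implicit Arguments.
Unset Strict Implicit.
Unset Printing Implicit Defensive.

Import Order.TTheory GRing.Theory Num.Theory.
Import numFieldNormedType.Exports.

Local Open Scope classical_set_scope.
Local Open Scope ring_scope.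
Local Open Scope complex_scope.
Local Open Scope quotient_scope.

Section Subgroups.
Variable T : groupType.

Definition is_subgroup (A : set T) : Prop :=
  [/\ A 1%g, forall x y, A x -> A y -> A (x * y)%g & forall x, A x -> A x^-1%g].

Record subgroup := Subgroup {
  subgroup_set :> set T;
  subgroupP : is_subgroup subgroup_set }.

Lemma is_subgroup_smallest (S : set T) : is_subgroup (smallest is_subgroup S).
Proof.
split=> [A [[]] // | x y Sx Sy A PA | x Sx A PA].
- by case: (PA) => -[_ AM _] _; apply: AM; [exact: Sx | exact: Sy].
- by case: (PA) => -[_ _ AV] _; apply: AV; exact: Sx.
Qed.

Definition generated (S : set T) : subgroup :=
  Subgroup (is_subgroup_smallest S).

End Subgroups.

Section OrbitSpaces.
Variables (T : groupType) (X : choiceType).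

Record laction := Laction {
  lact :> T -> X -> X;
  lact1 : forall x, lact 1%g x = x;
  lactM : forall g h x, lact (g * h)%g x = lact g (lact h x) }.

Variables (to : laction) (Gam : subgroup T).

Definition orbit_rel : rel X :=
  fun x y => `[< exists2 c, subgroup_set Gam c & y = to c x >].

Lemma orbit_rel_refl : reflexive orbit_rel.
Proof.
move=> x; apply/asboolP; exists 1%g; last by rewrite lact1.
by case: (subgroupP Gam).
Qed.

Lemma orbit_rel_sym : symmetric orbit_rel.
Proof.
have [_ _ GV] := subgroupP Gam.
suff imp x y : orbit_rel x y -> orbit_rel y x.
  by move=> x y; apply/idP/idP; exact: imp.
move=> /asboolP[c Gc ->]; apply/asboolP; exists c^-1%g; first exact: GV.
by rewrite -lactM mulVg lact1.
Qed.

Lemma orbit_rel_trans : transitive orbit_rel.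
Proof.
have [_ GM _] := subgroupP Gam.
move=> y x z /asboolP[c Gc ->] /asboolP[d Gd ->]; apply/asboolP.
by exists (d * c)%g; [exact: GM | rewrite lactM].
Qed.

Definition orbit_equiv : equiv_rel X :=
  EquivRel orbit_rel orbit_rel_refl orbit_rel_sym orbit_rel_trans.

Definition orbit_space := {eq_quot orbit_equiv}.
HB.instance Definition _ := Choice.on orbit_space.
HB.instance Definition _ := Quotient.on orbit_space.

Lemma orbit_spaceP x y :
  \pi_orbit_space x = \pi_orbit_space y <->
  exists2 c, subgroup_set Gam c & y = to c x.
Proof.
by split=> [/(@eqmodP _ orbit_equiv)/asboolP|
            /asboolP/(@eqmodP _ orbit_equiv)].
Qed.

End OrbitSpaces.

Section SL2.
Variable R : realType.

Definition SL2 : Type := {M : 'M[R]_2 | \det M == 1}.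
HB.instance Definition _ := SubType.on SL2.
HB.instance Definition _ := Choice.on SL2.
HB.instance Definition _ :=
  Topological.copy SL2 (initial_topology (val : SL2 -> 'M[R]_2)).

Lemma SL2_det (M : SL2) : \det (val M) = 1.
Proof. exact/eqP/(valP M). Qed.

Lemma SL2_mul_subproof (M N : SL2) : \det (val M *m val N) == 1.
Proof. by rewrite det_mulmx !SL2_det mulr1. Qed.

Lemma SL2_one_subproof : \det (1%:M : 'M[R]_2) == 1.
Proof. by rewrite det1. Qed.

Lemma SL2_inv_subproof (M : SL2) : \det (invmx (val M)) == 1.
Proof. by rewrite det_inv SL2_det invr1. Qed.

Definition SL2_mul (M N : SL2) : SL2 :=
  exist _ (val M *m val N) (SL2_mul_subproof M N).
Definition SL2_one : SL2 := exist _ 1%:M SL2_one_subproof.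
Definition SL2_inv (M : SL2) : SL2 :=
  exist _ (invmx (val M)) (SL2_inv_subproof M).

Lemma SL2_unitmx (M : SL2) : val M \in unitmx.
Proof. by rewrite unitmxE SL2_det unitr1. Qed.

Fact SL2_mulA : associative SL2_mul.
Proof. by move=> M N P; apply/val_inj; rewrite /= mulmxA. Qed.
Fact SL2_mul1 : left_id SL2_one SL2_mul.
Proof. by move=> M; apply/val_inj; rewrite /= mul1mx. Qed.
Fact SL2_mulr1 : right_id SL2_one SL2_mul.
Proof. by move=> M; apply/val_inj; rewrite /= mulmx1. Qed.
Fact SL2_mulV : left_inverse SL2_one SL2_inv SL2_mul.
Proof. by move=> M; apply/val_inj; rewrite /= mulVmx// SL2_unitmx. Qed.
Fact SL2_mulrV : right_inverse SL2_one SL2_inv SL2_mul.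
Proof. by move=> M; apply/val_inj; rewrite /= mulmxV// SL2_unitmx. Qed.

HB.instance Definition _ :=
  isGroup.Build SL2 SL2_mulA SL2_mul1 SL2_mulr1 SL2_mulV SL2_mulrV.

Definition SL2_pm : rel SL2 :=
  fun M N => (val M == val N) || (val M == - val N).

Lemma SL2_pm_refl : reflexive SL2_pm.
Proof. by move=> M; rewrite /SL2_pm eqxx. Qed.

Lemma SL2_pm_sym : symmetric SL2_pm.
Proof. by move=> M N; rewrite /SL2_pm eq_sym -eqr_oppLR (eq_sym (- _)). Qed.

Lemma SL2_pm_trans : transitive SL2_pm.
Proof.
move=> N M P; rewrite /SL2_pm => /orP[] /eqP -> // /orP[] /eqP ->.
  by rewrite eqxx orbT.
by rewrite opprK eqxx.
Qed.

Definition SL2_pm_equiv : equiv_rel SL2 :=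
  EquivRel SL2_pm SL2_pm_refl SL2_pm_sym SL2_pm_trans.

Definition PSL2 : Type := quotient_topology {eq_quot SL2_pm_equiv}.
HB.instance Definition _ := Quotient.on PSL2.
HB.instance Definition _ := Topological.on PSL2.

Lemma PSL2P (M N : SL2) :
  \pi_PSL2 M = \pi_PSL2 N <-> val M = val N \/ val M = - val N.
Proof.
split=> [/(@eqmodP _ SL2_pm_equiv)/orP[]/eqP|eMN]; [by left|by right|].
by apply/(@eqmodP _ SL2_pm_equiv)/orP; case: eMN => /eqP; [left|right].
Qed.

Lemma PSL2_repr (M : SL2) :
  val (repr (\pi_PSL2 M)) = val M \/ val (repr (\pi_PSL2 M)) = - val M.
Proof. by apply/PSL2P; exact: reprK. Qed.

Definition PSL2_mul (g h : PSL2) : PSL2 := \pi_PSL2 (repr g * repr h)%g.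
Definition PSL2_one : PSL2 := \pi_PSL2 1%g.
Definition PSL2_inv (g : PSL2) : PSL2 := \pi_PSL2 (repr g)^-1%g.

Lemma PSL2_mul_pi (M N : SL2) : PSL2_mul (\pi_PSL2 M) (\pi_PSL2 N)
  = \pi_PSL2 (M * N)%g.
Proof.
apply/PSL2P => /=.
case: (PSL2_repr M) => ->; case: (PSL2_repr N) => ->;
by rewrite ?mulNmx ?mulmxN ?opprK; auto.
Qed.

Lemma PSL2_inv_pi (M : SL2) : PSL2_inv (\pi_PSL2 M) = \pi_PSL2 M^-1%g.
Proof.
apply/PSL2P => /=.
case: (PSL2_repr M) => ->; [by left | right].
by rewrite -scaleN1r invmxZ ?unitmxZ ?unitrN1 ?SL2_unitmx// invrN1 scaleN1r.
Qed.

Lemma PSL2W (P : PSL2 -> Prop) :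
  (forall M, P (\pi_PSL2 M)) -> forall g, P g.
Proof. by move=> Ppi g; rewrite -[g]reprK; exact: Ppi. Qed.

Fact PSL2_mulA : associative PSL2_mul.
Proof.
elim/PSL2W=> M; elim/PSL2W=> N; elim/PSL2W=> P.
by rewrite !(PSL2_mul_pi M, PSL2_mul_pi N, PSL2_mul_pi (M * N)%g) mulgA.
Qed.
Fact PSL2_mul1 : left_id PSL2_one PSL2_mul.
Proof. by elim/PSL2W=> M; rewrite (PSL2_mul_pi 1%g M) mul1g. Qed.
Fact PSL2_mulr1 : right_id PSL2_one PSL2_mul.
Proof. by elim/PSL2W=> M; rewrite (PSL2_mul_pi M 1%g) mulg1. Qed.
Fact PSL2_mulV : left_inverse PSL2_one PSL2_inv PSL2_mul.
Proof.
by elim/PSL2W=> M; rewrite (PSL2_inv_pi M) (PSL2_mul_pi M^-1%g M) mulVg.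
Qed.
Fact PSL2_mulrV : right_inverse PSL2_one PSL2_inv PSL2_mul.
Proof.
by elim/PSL2W=> M; rewrite (PSL2_inv_pi M) (PSL2_mul_pi M M^-1%g) mulgV.
Qed.

HB.instance Definition _ :=
  isGroup.Build PSL2 PSL2_mulA PSL2_mul1 PSL2_mulr1 PSL2_mulV PSL2_mulrV.

End SL2.

Section Hyperbolic.
Variable R : realType.
Local Notation C := R[i].

(* [None] is the point at infinity. *)
Definition sphere : Type := option C.

Definition P1R : set sphere := [set None] `|` [set Some x%:C | x in [set: R]].

Definition hplane : Type := {z : C | 0 < complex.Im z}.
HB.instance Definition _ := SubType.on hplane.
HB.instance Definition _ := Choice.on hplane.
HB.instance Definition _ :=
  Topological.copy hplane (initial_topology (val : hplane -> C^o)).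

Definition hplane_i : hplane := exist _ ('i : C) ltr01.

Definition mobius_num (M : 'M[R]_2) (z : C) : C := (M 0 0)%:C * z + (M 0 1)%:C.
Definition mobius_den (M : 'M[R]_2) (z : C) : C := (M 1 0)%:C * z + (M 1 1)%:C.

Definition mobius (M : 'M[R]_2) (z : sphere) : sphere :=
  if z is Some w then
    if mobius_den M w == 0 then None else Some (mobius_num M w / mobius_den M w)
  else if M 1 0 == 0 then None else Some (M 0 0 / M 1 0)%:C.

Definition sphere_act (g : PSL2 R) : sphere -> sphere := mobius (val (repr g)).

Lemma mobiusN (M : 'M[R]_2) z : mobius (- M) z = mobius M z.
Proof.
case: z => [w|] /=; last by rewrite !mxE oppr_eq0 invrN mulrNN.
have -> : mobius_den (- M) w = - mobius_den M w
  by rewrite /mobius_den !mxE !rmorphN mulNr opprD.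
have -> : mobius_num (- M) w = - mobius_num M w
  by rewrite /mobius_num !mxE !rmorphN mulNr opprD.
by rewrite oppr_eq0 invrN mulrNN.
Qed.

Lemma sphere_act_pi (M : SL2 R) z :
  sphere_act (\pi_(PSL2 R) M) z = mobius (val M) z.
Proof. by rewrite /sphere_act; case: (PSL2_repr M) => ->; rewrite ?mobiusN. Qed.

Lemma det_SL2 (M : SL2 R) :
  val M 0 0 * val M 1 1 - val M 0 1 * val M 1 0 = 1.
Proof.
rewrite -[RHS](SL2_det M); move: (val M) => A.
rewrite (expand_det_row _ 0) !big_ord_recl big_ord0 addr0.
rewrite /cofactor !det_mx11 !mxE /= expr0 mul1r expr1 mulN1r mulrN.
by congr (_ * A _ _ - A _ _ * A _ _); apply/val_inj.
Qed.

Lemma den_neq0 (M : SL2 R) (z : hplane) : mobius_den (val M) (val z) != 0.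
Proof.
have := det_SL2 M; case: z => -[x y] /= y_gt0 dM; apply/eqP.
rewrite /mobius_den; case=> /=.
rewrite !(mul0r, subr0, addr0, add0r) => re0 /eqP.
rewrite mulf_eq0 (gt_eqF y_gt0) orbF => /eqP c0.
move: dM re0; rewrite c0 mul0r add0r => dM d0.
by move/eqP: dM; rewrite d0 !mulr0 subr0 eq_sym oner_eq0.
Qed.

Lemma Im_mobius (M : SL2 R) (z : hplane) :
  0 < complex.Im (mobius_num (val M) (val z) / mobius_den (val M) (val z)).
Proof.
have := den_neq0 M z; have := det_SL2 M; case: z => -[x y] /= y_gt0.
rewrite /mobius_num /mobius_den; set a := val M 0 0; set b := val M 0 1.
set c := val M 1 0; set d := val M 1 1 => dM.
rewrite eq_complex /= !(mul0r, subr0, addr0, add0r) => nz.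
have q_gt0 : 0 < (c * x + d) ^+ 2 + (c * y) ^+ 2.
  rewrite lt_def addr_ge0 ?sqr_ge0// andbT paddr_eq0 ?sqr_ge0//.
  by rewrite !sqrf_eq0.
set q := (_ + _ : R) in q_gt0 *.
rewrite (_ : _ + _ = y / q) ?divr_gt0//.
have -> : y / q = (a * d - b * c) * y / q by rewrite dM mul1r.
by ring.
Qed.

Definition mobius_hplane (M : SL2 R) (z : hplane) : hplane :=
  exist _ (mobius_num (val M) (val z) / mobius_den (val M) (val z))
    (Im_mobius M z).

Definition hplane_act (g : PSL2 R) : hplane -> hplane := mobius_hplane (repr g).

Lemma hplane_act_sphere (g : PSL2 R) (z : hplane) :
  Some (val (hplane_act g z)) = sphere_act g (Some (val z)).
Proof. by rewrite /sphere_act /= (negbTE (den_neq0 _ _)). Qed.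

Lemma hplane_act_pi (M : SL2 R) z :
  hplane_act (\pi_(PSL2 R) M) z = mobius_hplane M z.
Proof.
apply: val_inj; apply: Some_inj; rewrite hplane_act_sphere sphere_act_pi /=.
by rewrite (negbTE (den_neq0 _ _)).
Qed.

Lemma hplane_act1 z : hplane_act 1%g z = z.
Proof.
rewrite (_ : 1%g = \pi_(PSL2 R) 1%g)// hplane_act_pi; apply: val_inj.
by rewrite /= /mobius_num /mobius_den !mxE /= mul1r mul0r add0r addr0 divr1.
Qed.

Lemma hplane_actM g h z :
  hplane_act (g * h)%g z = hplane_act g (hplane_act h z).
Proof.
have -> : (g * h)%g = \pi_(PSL2 R) (repr g * repr h)%g by [].
rewrite hplane_act_pi /hplane_act; apply: val_inj.
move: (repr g) (repr h) => M N /=.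
have nz1 := den_neq0 N z; have nz2 := den_neq0 M (mobius_hplane N z).
have nz3 := den_neq0 (M * N)%g z.
have mulE i j : (val M *m val N) i j
    = val M i 0 * val N 0 j + val M i 1 * val N 1 j.
  rewrite mxE !big_ord_recl big_ord0 addr0.
  by congr (_ + val M i _ * val N _ j); apply/val_inj.
move: nz1 nz2 nz3.
rewrite /= /mobius_num /mobius_den !mulE !rmorphD !rmorphM /=.
move=> nz1 nz2 nz3; field; rewrite nz1 /=.
by apply: contra_neq nz3 => <-; ring.
Qed.

End Hyperbolic.

Section WeylChamberFlow.
Variables (R : realType) (r : nat).

Definition PSL2r : Type := {ptws 'I_r -> PSL2 R}.
HB.instance Definition _ := Choice.copy PSL2r ('I_r -> PSL2 R).
HB.instance Definition _ := Topological.copy PSL2r {ptws 'I_r -> PSL2 R}.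

Definition G_mul (g h : PSL2r) : PSL2r := fun j => (g j * h j)%g.
Definition G_one : PSL2r := fun=> 1%g.
Definition G_inv (g : PSL2r) : PSL2r := fun j => (g j)^-1%g.

Fact G_mulA : associative G_mul.
Proof. by move=> g h k; apply/funext => j; exact: mulgA. Qed.
Fact G_mul1 : left_id G_one G_mul.
Proof. by move=> g; apply/funext => j; exact: mul1g. Qed.
Fact G_mulr1 : right_id G_one G_mul.
Proof. by move=> g; apply/funext => j; exact: mulg1. Qed.
Fact G_mulV : left_inverse G_one G_inv G_mul.
Proof. by move=> g; apply/funext => j; exact: mulVg. Qed.
Fact G_mulrV : right_inverse G_one G_inv G_mul.
Proof. by move=> g; apply/funext => j; exact: mulgV. Qed.

HB.instance Definition _ :=
  isGroup.Build PSL2r G_mulA G_mul1 G_mulr1 G_mulV G_mulrV.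

Definition spaceX : Type := {ptws 'I_r -> hplane R}.
HB.instance Definition _ := Choice.copy spaceX ('I_r -> hplane R).
HB.instance Definition _ := Topological.copy spaceX {ptws 'I_r -> hplane R}.

Definition origin : spaceX := fun=> hplane_i R.

Definition X_act (g : PSL2r) (x : spaceX) : spaceX :=
  fun j => hplane_act (g j) (x j).

Fact X_act1 x : X_act 1%g x = x.
Proof. by apply/funext => j; exact: hplane_act1. Qed.
Fact X_actM g h x : X_act (g * h)%g x = X_act g (X_act h x).
Proof. by apply/funext => j; exact: hplane_actM. Qed.

Definition X_laction : laction PSL2r spaceX := Laction X_act1 X_actM.

Definition G_laction : laction PSL2r PSL2r :=
  Laction (@mul1g PSL2r) (fun g h x => esym (mulgA g h x)).

Definition a_mx (t : R) : 'M[R]_2 :=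
  diag_mx (\row_(i < 2) expR (if i == 0 then t / 2 else - (t / 2))).

Lemma a_mx_subproof t : \det (a_mx t) == 1.
Proof.
rewrite det_diag !big_ord_recl big_ord0 mulr1 !mxE /=.
by rewrite -expRD subrr expR0.
Qed.

Definition a_ (t : R) : PSL2 R :=
  \pi_(PSL2 R) (exist _ (a_mx t) (a_mx_subproof t)).

Definition groupA : set PSL2r :=
  [set a | exists t : 'I_r -> R, forall j, a j = a_ (t j)].

Definition groupAreg : set PSL2r :=
  [set a | exists t : 'I_r -> R,
    (forall j, t j != 0) /\ forall j, a j = a_ (t j)].

Variable Gam : subgroup PSL2r.

Definition quotG : Type := orbit_space G_laction Gam.
HB.instance Definition _ := Quotient.on quotG.

Definition piGam (g : PSL2r) : quotG := \pi_quotG g.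

Definition spaceY : Type := quotient_topology (orbit_space X_laction Gam).
HB.instance Definition _ := Quotient.on spaceY.
HB.instance Definition _ := Topological.on spaceY.

(* Gam g |-> Gam g a, independently of the representative by [flow_pi]. *)
Definition flow (x : quotG) (a : PSL2r) : quotG := piGam (repr x * a)%g.

(* Gam g |-> Gam g K, where G / K is identified with spaceX by
   g K |-> g (i, ..., i). *)
Definition footpoint (x : quotG) : spaceY := \pi_spaceY (X_act (repr x) origin).

Lemma piGamP g h :
  piGam g = piGam h <-> exists2 c, subgroup_set Gam c & h = (c * g)%g.
Proof. exact: (orbit_spaceP G_laction). Qed.

Lemma repr_piGam g : exists2 c, subgroup_set Gam c & g = (c * repr (piGam g))%g.
Proof. by apply/piGamP; exact: reprK. Qed.

Lemma flow_pi g a : flow (piGam g) a = piGam (g * a)%g.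
Proof.
have [c Gc gE] := repr_piGam g.
by apply/piGamP; exists c => //; rewrite {1}gE mulgA.
Qed.

Lemma footpoint_pi g : footpoint (piGam g) = \pi_spaceY (X_act g origin).
Proof.
have [c Gc gE] := repr_piGam g.
apply/(orbit_spaceP X_laction); exists c => //.
by rewrite {1}gE X_actM.
Qed.

(* The point Gam g A of Gam \ G / A, as the A-orbit of Gam g in Gam \ G. *)
Definition flat_of (x : quotG) : set quotG := [set flow x a | a in groupA].

Definition oriented_flat (F : set quotG) : Prop := exists x, F = flat_of x.

Definition compact_flat (F : set quotG) : Prop := compact (footpoint @` F).

Definition intersects_in (F S : set quotG) (x : quotG) : Prop :=
  S x /\ flat_of x = F.

Definition discrete_intersection (S : set quotG) (x : quotG) : Prop :=
  exists U : set PSL2r,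
    [/\ U `<=` groupA, within groupA (nbhs (1%g : PSL2r)) U &
      forall a, (U `&` groupAreg) a -> ~ S (flow x a)].

Definition cross_section (S : set quotG) : Prop :=
  (forall F, oriented_flat F -> compact_flat F ->
     exists x, intersects_in F S x) /\
  (forall F x, oriented_flat F -> intersects_in F S x ->
     discrete_intersection S x).

Definition set_of_representatives (E : set PSL2r) (S : set quotG) : Prop :=
  set_bij E S piGam.

End WeylChamberFlow.

Section Schottky.
Variable R : realType.
Local Notation C := R[i].

Definition cdisk (c rho : R) : set C := [set z | `|z - c%:C| <= rho%:C].
Definition odisk (c rho : R) : set C := [set z | `|z - c%:C| < rho%:C].

(* The indices 1, ..., q and -1, ..., -q are (k, true) and (k, false), with
   k shifted by one. *)
Record schottky_data := SchottkyData {
  srank : nat;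
  srank_gt0 : (0 < srank)%N;
  scenter : 'I_srank * bool -> R;
  sradius : 'I_srank * bool -> R;
  radius_gt0 : forall k, 0 < sradius k;
  disks_disjoint : trivIset setT (fun k => cdisk (scenter k) (sradius k));
  pairing : 'I_srank -> PSL2 R;
  pairingP : forall k,
    sphere_act (pairing k)
      @` (~` (Some @` cdisk (scenter (k, true)) (sradius (k, true)))) =
    Some @` odisk (scenter (k, false)) (sradius (k, false)) }.

Variable D : schottky_data.

Definition sindex : Type := 'I_(srank D) * bool.

Definition sdisk (k : sindex) : set C := cdisk (scenter k) (sradius k).

Definition schottky_group : subgroup (PSL2 R) := generated (range (@pairing D)).

Definition side (k : sindex) : set (hplane R) :=
  [set z | `|val z - (scenter k)%:C| = (sradius k)%:C].

Definition forward (k : sindex) : set (sphere R) :=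
  @P1R R `\` (Some @` sdisk k).

End Schottky.

Section SchottkyProduct.
Variables (R : realType) (r : nat) (D : 'I_r -> schottky_data R).

Lemma schottky_product_subproof :
  is_subgroup [set g : PSL2r R r |
    forall j, subgroup_set (schottky_group (D j)) (g j)].
Proof.
split=> [j | g h Gg Gh j | g Gg j];
  have [G1 GM GV] := subgroupP (schottky_group (D j)).
- exact: G1.
- by apply: GM; [exact: Gg | exact: Gh].
- by apply: GV; exact: Gg.
Qed.

Definition schottky_product : subgroup (PSL2r R r) :=
  Subgroup schottky_product_subproof.

Definition Cm (m : forall j, sindex (D j)) : set (PSL2r R r) :=
  [set g | forall j, side (m j) (hplane_act (g j) (hplane_i R)) /\
                     forward (m j) (sphere_act (g j) None)].

Definition Crep : set (PSL2r R r) := \bigcup_m Cm m.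

Definition Chat : set (quotG schottky_product) :=
  piGam schottky_product @` Crep.

End SchottkyProduct.

Arguments Crep {R r} D.
Arguments Chat {R r} D.

(* Main.v *)
(* The signed hyperbolic distance from g(i) to the side s_k has hyperbolic sine
   equal to a quadratic form in the columns of g: with
   q_k(u, v) = ((u - c_k v)^2 - (rho_k v)^2) / (2 rho_k), it is
   sdist k g = q_k(first column) + q_k(second column), and the forward endpoint
   g(oo) lies in I_k iff q_k(first column) > 0. Along the flow the two terms
   are scaled by e^t and e^-t.

   Two facts carry the argument. Disjointness of the disks makes q_k + q_l
   positive definite, so sdist k + sdist l >= d > 0 for all k <> l. The side
   pairing g_k carries q_k to - q_{-k}, so it reverses the sign of the distance.
   Hence a nontrivial reduced word sends a point of the closed fundamental
   domain into a closed disk, and into an open one unless the word is a letter;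
   this gives uniqueness of representatives and discreteness. Conversely,
   while a point lies in the disk k, applying g_k raises the minimum of sdist
   by at least d, or makes it nonnegative; so every point has a translate in
   the fundamental domain.

   For a compact flat, follow one factor of the flow to +oo and take a cluster
   point in the quotient. If the geodesic crossed no side, one translate of it
   would stay in the fundamental domain; returning near the cluster point then
   only involves the identity and one letter, which is impossible for a
   geodesic leaving every bounded set. *)

From HB Require Import structures.
From mathcomp Require Import all_boot all_order all_algebra ring lra.
From mathcomp Require Import generic_quotient complex.
From mathcomp Require Import boolp classical_sets functions reals.
From mathcomp Require Import topology normedtype sequences exp.
Require Import Defs.

Set Implicit Arguments.
Unset Strict Implicit.
Unset Printing Implicit Defensive.

Import Order.TTheory GRing.Theory Num.Theory.
Import numFieldNormedType.Exports.

Local Open Scope classical_set_scope.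
Local Open Scope ring_scope.
Local Open Scope complex_scope.
Local Open Scope quotient_scope.

(** * Binary quadratic forms attached to disks *)

Section QuadraticForms.
Variable R : realType.
Implicit Types c rho u v x y : R.

Definition qform c rho u v : R :=
  ((u - c * v) ^+ 2 - (rho * v) ^+ 2) / (2 * rho).

Lemma qformN c rho u v : qform c rho (- u) (- v) = qform c rho u v.
Proof. by rewrite /qform; ring. Qed.

Lemma qformZ c rho x u v :
  qform c rho (x * u) (x * v) = x ^+ 2 * qform c rho u v.
Proof. by rewrite /qform; ring. Qed.

(** Completing the square turns the sum of the two forms into [A * (u - m * v) ^+ 2 + E * v ^+ 2],
    with [E > 0] because the disks are apart. The shear by [m] keeps the determinant 1, so the
    squared entries of the sheared matrix add up to at least 2. *)
Lemma qform_sum_ge c1 rho1 c2 rho2 : 0 < rho1 -> 0 < rho2 ->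
  rho1 + rho2 < `|c1 - c2| ->
  exists2 d, 0 < d & forall u v x y, u * y - x * v = 1 ->
    d <= (qform c1 rho1 u v + qform c1 rho1 x y)
       + (qform c2 rho2 u v + qform c2 rho2 x y).
Proof.
move=> r1 r2 far.
have s_gt0 : 0 < rho1 + rho2 by lra.
pose A := (rho1 + rho2) / (2 * rho1 * rho2).
pose m := (c1 * rho2 + c2 * rho1) / (rho1 + rho2).
pose E := ((c1 - c2) ^+ 2 - (rho1 + rho2) ^+ 2) / (2 * (rho1 + rho2)).
have A_gt0 : 0 < A by rewrite divr_gt0 // !mulr_gt0.
have E_gt0 : 0 < E.
  rewrite divr_gt0 ?mulr_gt0 // subr_gt0 -[ltRHS]real_normK ?num_real //.
  by rewrite ltr_pXn2r ?nnegrE ?normr_ge0 ?ltW.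
have sumE u v : qform c1 rho1 u v + qform c2 rho2 u v
    = A * (u - m * v) ^+ 2 + E * v ^+ 2.
  by rewrite /qform /A /m /E; field; rewrite !gt_eqF.
have [d d_gt0 [dA dE]] : exists2 d, 0 < d & d <= A /\ d <= E.
  exists (Num.min A E); first by rewrite lt_min A_gt0.
  by rewrite !ge_min !lexx orbT.
exists d => // u v x y uy.
rewrite addrACA !sumE.
set p := u - m * v; set q := x - m * y.
have pq : p * y - q * v = 1 by rewrite -uy /p /q; ring.
have le2 : 2 <= p ^+ 2 + v ^+ 2 + (q ^+ 2 + y ^+ 2).
  have := sqr_ge0 (p - y); have := sqr_ge0 (q + v); rewrite !expr2; nra.
have dAp : d * (p ^+ 2 + q ^+ 2) <= A * (p ^+ 2 + q ^+ 2).
  by rewrite ler_wpM2r // addr_ge0 ?sqr_ge0.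
have dEp : d * (v ^+ 2 + y ^+ 2) <= E * (v ^+ 2 + y ^+ 2).
  by rewrite ler_wpM2r // addr_ge0 ?sqr_ge0.
have := ler_wpM2l (ltW d_gt0) le2; lra.
Qed.

Lemma quadratic_le0 (K L A : R) :
  (forall e, 0 < e -> K + L * e + A * e ^+ 2 < 0) -> K <= 0.
Proof.
move=> neg; rewrite leNgt; apply/negP => K_gt0.
(* This [e] satisfies e <= 1 and K - e (|L| + |A|) = K e > 0, so the quadratic would be positive at
   [e]. *)
pose S : R := `|L| + `|A| + K; pose e : R := K / S.
have S_gt0 : 0 < S by rewrite /S ltr_wpDl // addr_ge0.
have e_gt0 : 0 < e by rewrite divr_gt0.
have e_le1 : e <= 1 by rewrite ler_pdivrMr // mul1r /S lerDr addr_ge0.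
have eS : e * S = K by rewrite divfK // gt_eqF.
have hL : - `|L| * e <= L * e.
  by rewrite ler_wpM2r ?(ltW e_gt0) // lerNl ler_normr lexx orbT.
have hA : - `|A| * e <= A * e ^+ 2.
  apply: (@le_trans _ _ (- `|A| * e ^+ 2)).
    by rewrite !mulNr lerN2 ler_wpM2l // expr2 ger_pMr.
  by rewrite ler_wpM2r ?sqr_ge0 // lerNl ler_normr lexx orbT.
have Ke : 0 < K * e by rewrite mulr_gt0.
have := neg e e_gt0; move: eS; rewrite /S !mulrDr; clearbody e.
lra.
Qed.

(* A quadratic form of discriminant [4 rho'^2] that is negative exactly where
   [qform c rho] is positive has the same zeros, hence is a negative multiple
   of it, and the discriminant determines the factor. *)
Lemma qform_opposite c rho rho' (A B E : R) : 0 < rho -> 0 < rho' ->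
  B ^+ 2 - 4 * A * E = 4 * rho' ^+ 2 ->
  (forall u v, 0 < qform c rho u v <->
     A * u ^+ 2 + B * u * v + E * v ^+ 2 < 0) ->
  forall u v, (A * u ^+ 2 + B * u * v + E * v ^+ 2) / (2 * rho')
    = - qform c rho u v.
Proof.
move=> r_gt0 r'_gt0 disc posneg.
have i2r_gt0 : 0 < (2 * rho)^-1 by rewrite invr_gt0 mulr_gt0.
have posE u v : 0 < qform c rho u v <-> (rho * v) ^+ 2 < (u - c * v) ^+ 2.
  by rewrite /qform pmulr_lgt0 // subr_gt0.
(* The sign [s] treats both zeros [c + s * rho] at once. The value there is nonnegative because
   [qform] is not positive, and nonpositive as a limit of negative values from outside the disk. *)
have zero s : s ^+ 2 = 1 ->
    A * (c + s * rho) ^+ 2 + B * (c + s * rho) + E = 0.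
  move=> s2; apply/eqP; rewrite eq_le; apply/andP; split; last first.
    rewrite leNgt; apply/negP => neg.
    have /posneg/posE : A * (c + s * rho) ^+ 2 + B * (c + s * rho) * 1
      + E * 1 ^+ 2 < 0 by rewrite mulr1 expr1n mulr1.
    rewrite !mulr1 (_ : (_ - c) ^+ 2 = s ^+ 2 * rho ^+ 2); last by ring.
    by rewrite s2 mul1r ltxx.
  set K := (X in X <= 0).
  pose L := s * (2 * A * (c + s * rho) + B).
  apply: (@quadratic_le0 K L A) => e e_gt0.
  have /posneg : 0 < qform c rho (c + s * rho + s * e) 1.
    apply/posE; rewrite !mulr1.
    rewrite (_ : (_ - c) ^+ 2 = s ^+ 2 * (rho + e) ^+ 2); last by ring.
    by rewrite s2 mul1r ltr_pXn2r ?nnegrE //; lra.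
  apply: le_lt_trans; rewrite le_eqVlt; apply/orP; left; apply/eqP.
  have -> : A * e ^+ 2 = A * (s ^+ 2 * e ^+ 2) by rewrite s2 mul1r.
  by rewrite /K /L; ring.
have zp := zero 1 (expr1n _ _).
have zm : A * (c + -1 * rho) ^+ 2 + B * (c + -1 * rho) + E = 0.
  by apply: zero; rewrite sqrrN expr1n.
have BE : B = - 2 * c * A.
  apply: (@mulIf _ rho); first by rewrite gt_eqF.
  have : A * (c + 1 * rho) ^+ 2 + B * (c + 1 * rho) + E
       - (A * (c + -1 * rho) ^+ 2 + B * (c + -1 * rho) + E) = 0.
    by rewrite zp zm subrr.
  by nra.
have EE : E = A * (c ^+ 2 - rho ^+ 2).
  move: zp; rewrite BE => zp; apply/eqP; rewrite -subr_eq0 -zp.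
  by apply/eqP; ring.
have A_lt0 : A < 0.
  have /posneg : 0 < qform c rho 1 0.
    by apply/posE; rewrite !mulr0 subr0 expr0n expr1n.
  by rewrite expr0n expr1n /= !mulr0 !addr0 mulr1.
(* The discriminant fixes the factor up to sign, and [A < 0] fixes the sign. *)
have Ar : A * rho = - rho'.
  have : (- (A * rho)) ^+ 2 = rho' ^+ 2.
    by rewrite sqrrN; move: disc; rewrite BE EE; nra.
  move/eqP; rewrite eqrXn2 ?(ltW r'_gt0) // ?oppr_ge0; last by nra.
  by move/eqP => <-; rewrite opprK.
move=> u v; rewrite BE EE.
have -> : A * u ^+ 2 + - 2 * c * A * u * v + A * (c ^+ 2 - rho ^+ 2) * v ^+ 2
   = A * rho * (2 * qform c rho u v).
  by rewrite /qform; field; rewrite gt_eqF.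
by rewrite Ar; field; rewrite gt_eqF.
Qed.

End QuadraticForms.

(** * Boundary points in homogeneous coordinates *)

Section RealPoints.
Variable R : realType.
Implicit Types (c rho u v x y : R) (M : SL2 R).

(* The point of the sphere with real homogeneous coordinates [u : v]. *)
Definition rpoint u v : sphere R := if v == 0 then None else Some (u / v)%:C.

Lemma normc_real x : `|x%:C| = `|x|%:C.
Proof. by rewrite normc_def /= expr0n addr0 sqrtr_sqr. Qed.

Lemma qform_gt0E c rho u v : 0 < rho ->
  (0 < qform c rho u v) = (rho * `|v| < `|u - c * v|).
Proof.
move=> r_gt0; rewrite pmulr_lgt0 ?invr_gt0 ?mulr_gt0 // subr_gt0.
rewrite -[(rho * v) ^+ 2]real_normK ?num_real //.
rewrite -[ltRHS]real_normK ?num_real //.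
by rewrite ltr_pXn2r ?nnegrE // normrM (gtr0_norm r_gt0).
Qed.

Lemma qform_lt0E c rho u v : 0 < rho ->
  (qform c rho u v < 0) = (`|u - c * v| < rho * `|v|).
Proof.
move=> r_gt0; rewrite pmulr_llt0 ?invr_gt0 ?mulr_gt0 // subr_lt0.
rewrite -[(rho * v) ^+ 2]real_normK ?num_real //.
rewrite -[ltLHS]real_normK ?num_real //.
by rewrite ltr_pXn2r ?nnegrE // normrM (gtr0_norm r_gt0).
Qed.

Lemma divB_norm c u v : v != 0 -> `|u / v - c| = `|u - c * v| / `|v|.
Proof. by move=> v0; rewrite -normf_div mulrBl mulfK. Qed.

(** The pair (0, 0) is excluded because [rpoint] sends it to infinity, outside every disk, while the
    form vanishes there. *)
Lemma rpoint_cdiskN c rho u v : 0 < rho -> (u != 0) || (v != 0) ->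
  ~ (Some @` cdisk c rho) (rpoint u v) <-> 0 < qform c rho u v.
Proof.
move=> r_gt0; rewrite /rpoint qform_gt0E //; have [->|v0] := eqVneq v 0.
  rewrite orbF normr0 !mulr0 subr0 normr_gt0 => u0.
  by split=> // _ [].
move=> _; rewrite ltNge; split=> [nin|/negP le [w + [wE]]].
  apply/negP => le; apply: nin; exists (u / v)%:C => //=.
  rewrite /cdisk /= -rmorphB normc_real lecR divB_norm //.
  by rewrite ler_pdivrMr ?normr_gt0.
rewrite wE /cdisk /= -rmorphB normc_real lecR divB_norm //.
by rewrite ler_pdivrMr ?normr_gt0.
Qed.

Lemma rpoint_odisk c rho u v : 0 < rho ->
  (Some @` odisk c rho) (rpoint u v) <-> qform c rho u v < 0.
Proof.
move=> r_gt0; rewrite /rpoint qform_lt0E //; have [->|v0] := eqVneq v 0.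
  by rewrite normr0 !mulr0 subr0 normr_lt0; split=> // -[].
split=> [[w + [wE]]|lt].
  rewrite wE /odisk /= -rmorphB normc_real ltcR divB_norm //.
  by rewrite ltr_pdivrMr ?normr_gt0.
exists (u / v)%:C => //=.
rewrite /odisk /= -rmorphB normc_real ltcR divB_norm //.
by rewrite ltr_pdivrMr ?normr_gt0.
Qed.

Lemma mobius_rpoint M u v : (u != 0) || (v != 0) ->
  mobius (val M) (rpoint u v)
  = rpoint (val M 0 0 * u + val M 0 1 * v) (val M 1 0 * u + val M 1 1 * v).
Proof.
rewrite /rpoint; have [->|v0] := eqVneq v 0.
  rewrite orbF => u0 /=; rewrite !mulr0 !addr0 mulf_eq0 (negbTE u0) orbF.
  by case: eqVneq => // c0; congr (Some _%:C); field; rewrite u0 c0.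
move=> _ /=.
have denE : mobius_den (val M) (u / v)%:C
    = ((val M 1 0 * u + val M 1 1 * v) / v)%:C.
  by rewrite /mobius_den -rmorphM -rmorphD /=; congr (_%:C); field.
have numE : mobius_num (val M) (u / v)%:C
    = ((val M 0 0 * u + val M 0 1 * v) / v)%:C.
  by rewrite /mobius_num -rmorphM -rmorphD /=; congr (_%:C); field.
rewrite denE numE fmorph_eq0 mulf_eq0 invr_eq0 (negbTE v0) orbF.
case: eqVneq => // d0; congr Some.
by rewrite -fmorph_div /=; congr (_%:C); field; rewrite d0.
Qed.

(** With determinant 1, cross-multiplying equal finite images of finite points leaves [w - w' = 0];
    a collision of a finite point with infinity would make the determinant 0. *)
Lemma mobius_inj M : injective (mobius (val M)).
Proof.
have dM := det_SL2 M; set a := val M 0 0 in dM; set b := val M 0 1 in dM.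
set c := val M 1 0 in dM; set d := val M 1 1 in dM.
have dC : a%:C * d%:C - b%:C * c%:C = 1 by rewrite -!rmorphM -rmorphB dM.
case=> [w|] [w'|] //=; rewrite /mobius_num /mobius_den -/a -/b -/c -/d.
- case: eqVneq => [e|n]; case: eqVneq => [e'|n'] //; [move=> _|case=> E].
    congr Some; apply: (@mulfI _ c%:C).
      apply/eqP => c0; move: e dC; rewrite c0 mul0r add0r => ->.
      by rewrite !mulr0 subr0 => /eqP; rewrite eq_sym oner_eq0.
    by apply: (@addIr _ d%:C); rewrite e e'.
  congr Some; apply/eqP; rewrite -subr_eq0 -[w - w']mul1r -dC.
  move/eqP: E; rewrite eqr_div // -subr_eq0 => /eqP E.
  by apply/eqP; rewrite -[RHS]E; ring.
- case: eqVneq => [e|n]; case: eqVneq => [e'|n'] //; [move=> _|case=> E].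
    have d0 : d%:C = 0 by move: e; rewrite e' mul0r add0r.
    by move/eqP: dC; rewrite d0 e' !mulr0 subr0 eq_sym oner_eq0.
  move/eqP: E; rewrite fmorph_div /= eqr_div ?fmorph_eq0 // -subr_eq0 => /eqP E.
  case/eqP: (oner_neq0 R[i]); rewrite -[RHS]oppr0 -[in RHS]E -dC; ring.
- case: eqVneq => [e|n]; case: eqVneq => [e'|n'] //; [move=> _|case=> E].
    have d0 : d%:C = 0 by move: e'; rewrite e mul0r add0r.
    by move/eqP: dC; rewrite d0 e !mulr0 subr0 eq_sym oner_eq0.
  move/eqP: E; rewrite fmorph_div /= eqr_div ?fmorph_eq0 // -subr_eq0 => /eqP E.
  case/eqP: (oner_neq0 R[i]); rewrite -[RHS]E -dC; ring.
Qed.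

End RealPoints.

(** * Signed distances to the sides and their behavior under side pairings *)

Section SideForms.
Variables (R : realType) (D : schottky_data R).
Implicit Types (k l : sindex D) (M : SL2 R) (g h : PSL2 R) (j : 'I_2).

(** Otherwise the point dividing the segment between the centers in the ratio of the radii would lie
    in both disks. *)
Lemma disks_far k l : k != l ->
  sradius k + sradius l < `|scenter k - scenter l|.
Proof.
move=> kl; rewrite ltNge; apply/negP => le.
have rk := radius_gt0 k; have rl := radius_gt0 l.
have s_gt0 : 0 < sradius k + sradius l by rewrite addr_gt0.
pose p := (scenter k * sradius l + scenter l * sradius k)
  / (sradius k + sradius l).
have pk : p - scenter k
    = sradius k / (sradius k + sradius l) * (scenter l - scenter k).
  by rewrite /p; field; rewrite gt_eqF.
have pl : p - scenter l
    = sradius l / (sradius k + sradius l) * (scenter k - scenter l).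
  by rewrite /p; field; rewrite gt_eqF.
move/eqP: kl; apply; apply: (@disks_disjoint _ D) => //; exists p%:C; split.
  rewrite /cdisk /= -rmorphB normc_real lecR pk normrM distrC.
  rewrite gtr0_norm ?divr_gt0 // mulrAC ler_pdivrMr //.
  by rewrite ler_wpM2l // ltW.
rewrite /cdisk /= -rmorphB normc_real lecR pl normrM.
rewrite gtr0_norm ?divr_gt0 // mulrAC ler_pdivrMr //.
by rewrite ler_wpM2l // ltW.
Qed.

(** Column 0 represents the endpoint g(oo) and column 1 the endpoint g(0). The form is even, so the
    sign of the representative does not matter. *)
Definition endform k j g : R :=
  qform (scenter k) (sradius k) (val (repr g) 0 j) (val (repr g) 1 j).

Definition sdist k g : R := endform k 0 g + endform k 1 g.

Lemma endform_pi k j M : endform k j (\pi_(PSL2 R) M)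
  = qform (scenter k) (sradius k) (val M 0 j) (val M 1 j).
Proof.
by rewrite /endform; case: (PSL2_repr M) => -> //; rewrite !mxE qformN.
Qed.

Lemma mul2E (A B : 'M[R]_2) i j : (A *m B) i j = A i 0 * B 0 j + A i 1 * B 1 j.
Proof.
rewrite mxE !big_ord_recl big_ord0 addr0.
by congr (_ + A i _ * B _ j); apply/val_inj.
Qed.

Lemma endformM k j g h : endform k j (g * h)%g =
  qform (scenter k) (sradius k)
    (val (repr g) 0 0 * val (repr h) 0 j + val (repr g) 0 1 * val (repr h) 1 j)
    (val (repr g) 1 0 * val (repr h) 0 j + val (repr g) 1 1 * val (repr h) 1 j).
Proof. by rewrite (endform_pi k j (repr g * repr h)%g) /= !mul2E. Qed.

(** There are finitely many pairs of sides, so the constants of [qform_sum_ge] have a positive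
    minimum; diagonal pairs get the dummy value 1. *)
Lemma sdist_gap : exists2 d, 0 < d &
  forall k l, k != l -> forall g, d <= sdist k g + sdist l g.
Proof.
pose P (p : sindex D * sindex D) d := 0 < d /\
  (p.1 != p.2 -> forall g, d <= sdist p.1 g + sdist p.2 g).
have /choice[d dP] p : exists d, P p d.
  rewrite /P; have [_|kl] := boolP (p.1 == p.2); first by exists 1.
  have [d d_gt0 dle] :=
    qform_sum_ge (radius_gt0 p.1) (radius_gt0 p.2) (disks_far kl).
  exists d; split=> // _ g; apply: dle.
  by rewrite -[RHS](det_SL2 (repr g)); ring.
exists (\big[Num.min/1]_p d p).
  by apply/lt_bigmin => // p _; case: (dP p).
move=> k l kl g; apply: le_trans (bigmin_le_cond _ _ _) _; last first.
  by apply: (dP (k, l)).2.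
by [].
Qed.

(** Since [M] has determinant 1, pulling the form of [(i, false)] back by [M] keeps its
    discriminant. The pairing takes the exterior of one disk to the interior of the other, so the
    pullback is negative exactly where the form of [(i, true)] is positive, and [qform_opposite]
    applies. *)
Lemma qform_pairing (i : 'I_(srank D)) M u v : pairing i = \pi_(PSL2 R) M ->
  qform (scenter (i, false)) (sradius (i, false))
    (val M 0 0 * u + val M 0 1 * v) (val M 1 0 * u + val M 1 1 * v)
  = - qform (scenter (i, true)) (sradius (i, true)) u v.
Proof.
move=> gM; set c := scenter (i, false); set rho := sradius (i, false).
have r_gt0 := radius_gt0 (i, true); have r'_gt0 := radius_gt0 (i, false).
have dM := det_SL2 M; set Mx := val M in dM *.
pose A := (Mx 0 0 - c * Mx 1 0) ^+ 2 - (rho * Mx 1 0) ^+ 2.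
pose B := 2 * (Mx 0 0 - c * Mx 1 0) * (Mx 0 1 - c * Mx 1 1)
  - 2 * rho ^+ 2 * Mx 1 0 * Mx 1 1.
pose E := (Mx 0 1 - c * Mx 1 1) ^+ 2 - (rho * Mx 1 1) ^+ 2.
have qE x y : qform c rho (Mx 0 0 * x + Mx 0 1 * y) (Mx 1 0 * x + Mx 1 1 * y)
    = (A * x ^+ 2 + B * x * y + E * y ^+ 2) / (2 * rho).
  by rewrite /qform /A /B /E; ring.
rewrite qE; apply: qform_opposite => // [|x y].
  transitivity (4 * rho ^+ 2 * (Mx 0 0 * Mx 1 1 - Mx 0 1 * Mx 1 0) ^+ 2).
    by rewrite /A /B /E; ring.
  by rewrite dM expr1n mulr1.
have -> : (A * x ^+ 2 + B * x * y + E * y ^+ 2 < 0)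
    = (qform c rho (Mx 0 0 * x + Mx 0 1 * y) (Mx 1 0 * x + Mx 1 1 * y) < 0).
  by rewrite qE pmulr_llt0 // invr_gt0 mulr_gt0.
have [/andP[/eqP-> /eqP->]|xy] := boolP ((x == 0) && (y == 0)).
  by rewrite !mulr0 addr0 /qform !mulr0 subrr expr0n subrr !mul0r ltxx; split. 
rewrite negb_and in xy.
rewrite -rpoint_cdiskN // -rpoint_odisk // -mobius_rpoint // -pairingP gM.
split=> [nin|[s nin]].
  by exists (rpoint x y); rewrite ?sphere_act_pi.
by rewrite sphere_act_pi => /mobius_inj <-.
Qed.

Lemma endform_pairing (i : 'I_(srank D)) j g :
  endform (i, false) j (pairing i * g)%g = - endform (i, true) j g.
Proof. by rewrite endformM; apply: qform_pairing; rewrite reprK. Qed.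

Definition letter k : PSL2 R :=
  if k.2 then pairing k.1 else (pairing k.1)^-1%g.

Definition opp k : sindex D := (k.1, ~~ k.2).

Lemma oppK : involutive opp.
Proof. by case=> i b; rewrite /opp /= negbK. Qed.

Lemma letter_opp k : letter (opp k) = (letter k)^-1%g.
Proof. by case: k => i [] /=; rewrite /letter /= ?invgK. Qed.

Lemma endform_letter k j g :
  endform (opp k) j (letter k * g)%g = - endform k j g.
Proof.
case: k => i [] /=; first exact: endform_pairing.
apply: oppr_inj; rewrite opprK -(endform_pairing i).
by rewrite /letter /= mulgA mulgV mul1g.
Qed.

Lemma sdist_letter k g : sdist (opp k) (letter k * g)%g = - sdist k g.
Proof. by rewrite /sdist !endform_letter opprD. Qed.

Lemma endform_a0 k g t : endform k 0 (g * a_ t)%g = expR t * endform k 0 g.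
Proof.
rewrite -[g]reprK /a_ -[(_ * _)%g]/(PSL2_mul _ _) PSL2_mul_pi !endform_pi /=.
rewrite !mul2E /a_mx !mxE /= mulr1n !mulr0n !mulr0 !addr0.
rewrite ![_ * expR _]mulrC qformZ -expRM_natl; congr (expR _ * _).
by rewrite mulr2n mulrDl mul1r; field.
Qed.

Lemma endform_a1 k g t : endform k 1 (g * a_ t)%g = expR (- t) * endform k 1 g.
Proof.
rewrite -[g]reprK /a_ -[(_ * _)%g]/(PSL2_mul _ _) PSL2_mul_pi !endform_pi /=.
rewrite !mul2E /a_mx !mxE /= mulr1n !mulr0n !mulr0 !add0r.
rewrite ![_ * expR _]mulrC qformZ -expRM_natl; congr (expR _ * _).
by field.
Qed.

Lemma sdist_a k g t : sdist k (g * a_ t)%g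
  = expR t * endform k 0 g + expR (- t) * endform k 1 g.
Proof. by rewrite /sdist endform_a0 endform_a1. Qed.

Lemma forwardE k g : forward k (sphere_act g None) <-> 0 < endform k 0 g.
Proof.
have dM := det_SL2 (repr g).
have nz : (val (repr g) 0 0 != 0) || (val (repr g) 1 0 != 0).
  rewrite -negb_and; apply/negP => /andP[/eqP a0 /eqP c0].
  by move/eqP: dM; rewrite a0 c0 mul0r mulr0 subrr eq_sym oner_eq0.
rewrite /endform -(rpoint_cdiskN _ (radius_gt0 k) nz).
split=> [[]//|nin]; split=> //.
rewrite /sphere_act /=; case: eqVneq => _; [by left|right].
by exists (val (repr g) 0 0 / val (repr g) 1 0).
Qed.

(* The hyperbolic sine of the signed distance of a point to the side [k],
   positive outside the disk. *)
Definition hdist k (z : hplane R) : R :=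
  ((complex.Re (val z) - scenter k) ^+ 2 + complex.Im (val z) ^+ 2
   - sradius k ^+ 2) / (2 * sradius k * complex.Im (val z)).

Lemma sideE k z : side k z <-> hdist k z = 0.
Proof.
case: z => -[x y] /= y_gt0; rewrite /side /hdist /=.
have r_gt0 := radius_gt0 k.
have /lt0r_neq0 nz : 0 < 2 * sradius k * y by rewrite !mulr_gt0.
rewrite normc_def /= subr0; split=> [[E]|/eqP].
  by rewrite -E sqr_sqrtr ?addr_ge0 ?sqr_ge0 // subrr mul0r.
rewrite mulf_eq0 invr_eq0 (negbTE nz) orbF subr_eq0 => /eqP ->.
by rewrite sqrtr_sqr gtr0_norm.
Qed.

Lemma SL2_row1_gt0 M : 0 < val M 1 0 ^+ 2 + val M 1 1 ^+ 2.
Proof.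
rewrite lt_def addr_ge0 ?sqr_ge0 // andbT paddr_eq0 ?sqr_ge0 // !sqrf_eq0.
apply/negP => /andP[/eqP c0 /eqP d0]; move/eqP: (det_SL2 M).
by rewrite d0 c0 !mulr0 subrr eq_sym oner_eq0.
Qed.

Lemma hplane_act_i M : val (hplane_act (\pi_(PSL2 R) M) (hplane_i R)) =
  ((val M 0 0 * val M 1 0 + val M 0 1 * val M 1 1)
     / (val M 1 0 ^+ 2 + val M 1 1 ^+ 2))
  +i* (val M 1 0 ^+ 2 + val M 1 1 ^+ 2)^-1.
Proof.
have := SL2_row1_gt0 M; have dM := det_SL2 M.
rewrite hplane_act_pi; have : mobius_den (val M) ('i : R[i]) != 0.
  exact: (den_neq0 M (hplane_i R)).
rewrite -[LHS]/(mobius_num (val M) 'i / mobius_den (val M) 'i).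
rewrite /mobius_num /mobius_den; move: (val M) dM => A dM nz D_gt0.
apply: (canLR (mulfK nz)); apply/eqP.
rewrite eq_complex /= !(mul0r, mulr0, mulr1, subr0, addr0, add0r, oppr0).
set D' := (A 1 0 ^+ 2 + _) in D_gt0 *; set u := D'^-1.
have uD : u * D' = 1 by rewrite mulVf // gt_eqF.
(* Each difference is a combination of [1 - u * D'] and of 1 minus the determinant, both of which
   vanish. *)
apply/andP; split; rewrite -subr_eq0; apply/eqP.
  transitivity (A 0 1 * (1 - u * D')
    + u * A 1 0 * (1 - (A 0 0 * A 1 1 - A 0 1 * A 1 0))).
    by rewrite /D'; ring.
  by rewrite uD dM subrr !mulr0 addr0.
transitivity (A 0 0 * (1 - u * D')
  - u * A 1 1 * (1 - (A 0 0 * A 1 1 - A 0 1 * A 1 0))).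
  by rewrite /D'; ring.
by rewrite uD dM subrr !mulr0 subr0.
Qed.

Lemma hdist_i k g : hdist k (hplane_act g (hplane_i R)) = sdist k g.
Proof.
rewrite -[g]reprK /hdist hplane_act_i /sdist !endform_pi.
have := SL2_row1_gt0 (repr g); have := det_SL2 (repr g).
have := radius_gt0 k; rewrite /qform.
move: (scenter k) (sradius k) (val _) => c rho A r_gt0 dA D_gt0 /=.
set D' := (A 1 0 ^+ 2 + _) in D_gt0 *.
(* Inserting the squared determinant leaves a rational identity in the matrix entries. *)
have -> : D'^-1 ^+ 2 = (A 0 0 * A 1 1 - A 0 1 * A 1 0) ^+ 2 * D'^-1 ^+ 2.
  by rewrite dA expr1n mul1r.
rewrite /D'; field; rewrite !gt_eqF //.
Qed.

End SideForms.

(** * Reduced words, the fundamental domain and its tiling *)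

Section Words.
Variables (R : realType) (D : schottky_data R).
Implicit Types (k l m : sindex D) (s : seq (sindex D)) (c g h : PSL2 R).
Local Notation Gam := (subgroup_set (schottky_group D)).

Definition word_eval s : PSL2 R := foldr (fun k g => letter k * g)%g 1%g s.

Definition reduced s : bool := sorted (fun k l => l != opp k) s.

Lemma word_eval_cat s1 s2 :
  word_eval (s1 ++ s2) = (word_eval s1 * word_eval s2)%g.
Proof. by elim: s1 => [|k s1 IH] /=; rewrite ?mul1g // IH mulgA. Qed.

Lemma word_evalV s : (word_eval s)^-1%g = word_eval (rev (map (@opp R D) s)).
Proof.
elim: s => [|k s IH] /=; first by rewrite invg1.
by rewrite invgM IH rev_cons -cats1 word_eval_cat /= mulg1 letter_opp.
Qed.

Lemma letter_group k : Gam (letter k).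
Proof.
have [_ _ GV] := subgroupP (schottky_group D).
have pair (i : 'I_(srank D)) : Gam (pairing i).
  by move=> A [_ sub]; apply: sub; exists i.
by case: k => i [] /=; rewrite /letter /=; [|apply: GV]; exact: pair.
Qed.

Lemma reduced_word s : exists2 s', reduced s' & word_eval s' = word_eval s.
Proof.
elim: s => [|k s [s' red e]] /=; first by exists [::].
rewrite -{}e.
case: s' red => [|l t] red; first by exists [:: k].
have [lk|lk] := eqVneq l (opp k).
  exists t; first exact: path_sorted red.
  by rewrite /= lk letter_opp mulgA mulgV mul1g.
by exists [:: k, l & t]; rewrite //= lk.
Qed.

Lemma group_word c : Gam c -> exists2 s, reduced s & c = word_eval s.
Proof.
move=> Gc; suff [s ->] : exists s, c = word_eval s.
  by have [s' red <-] := reduced_word s; exists s'.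
apply: (Gc [set c | exists s, c = word_eval s]); split.
  split=> [|_ _ [s1 ->] [s2 ->]|_ [s ->]].
  - by exists [::].
  - by exists (s1 ++ s2); rewrite word_eval_cat.
  - by exists (rev (map (@opp R D) s)); rewrite word_evalV.
by move=> _ [i _ <-]; exists [:: (i, true)]; rewrite /= mulg1.
Qed.

Definition fdom g : Prop := forall k, 0 <= sdist k g.

(** Ping-pong: the shorter word puts the point in the closed disk [opp l]. Reducedness gives
    [k != opp l], so by the gap the point is strictly outside the disk [k], and [letter k] takes it
    into the open disk [opp k]. Only a single letter can leave it on a boundary. *)
Lemma word_sdist_le0 k s g : reduced (k :: s) -> fdom g ->
  sdist (opp k) (word_eval (k :: s) * g)%g <= 0 /\
  (s = [::] \/ sdist (opp k) (word_eval (k :: s) * g)%g < 0).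
Proof.
have [d d_gt0 gap] := sdist_gap D => + fg.
elim: s k => [|l s IH] k red.
  by rewrite /= mulg1 sdist_letter oppr_le0; split; [exact: fg|left].
have [lk reds] : l != opp k /\ reduced (l :: s) by apply/andP.
have [le0 _] := IH l reds.
have kl : k != opp l by apply: contraNneq lk => ->; rewrite oppK.
have := gap k (opp l) kl (word_eval (l :: s) * g)%g.
set x := sdist (opp l) _ in le0 *; move=> kx.
rewrite [word_eval (k :: _)]/= -mulgA sdist_letter.
have : 0 < sdist k (word_eval (l :: s) * g)%g by lra.
by rewrite -oppr_lt0 => lt0; split; [exact: ltW|right].
Qed.

Lemma tile_cases c g : Gam c -> fdom g ->
  [\/ c = 1%g, exists k, c = letter k | exists k, sdist k (c * g)%g < 0].
Proof.
move=> /group_word[[|k s] red ->] fg; first by constructor 1.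
have [_ [s0|lt0]] := word_sdist_le0 red fg.
  by constructor 2; exists k; rewrite s0 /= mulg1.
by constructor 3; exists (opp k).
Qed.

Lemma fdom_interior c g : Gam c -> (forall k, 0 < sdist k g) ->
  fdom (c * g)%g -> c = 1%g.
Proof.
move=> Gc g_gt0 fcg; have fg : fdom g by move=> k; exact: ltW.
case: (tile_cases Gc fg) => [//|[k ck]|[k lt0]].
  by have := fcg (opp k); rewrite ck sdist_letter oppr_ge0 leNgt g_gt0.
by have := fcg k; rewrite leNgt lt0.
Qed.

Lemma fdom_side k g : sdist k g = 0 -> fdom g.
Proof.
have [d d_gt0 gap] := sdist_gap D => kg l.
have [->|lk] := eqVneq l k; first by rewrite kg.
by have := gap _ _ lk g; rewrite kg addr0; apply: le_trans; exact: ltW.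
Qed.

Lemma fdom_reach g : exists2 c, Gam c & fdom (c * g)%g.
Proof.
have [d d_gt0 gap] := sdist_gap D.
have [G1 GM _] := subgroupP (schottky_group D).
suff reach n h : (forall k, - (n%:R * d) <= sdist k h) ->
    exists2 c, Gam c & fdom (c * h)%g.
  have [n nP] : exists n : nat, forall k, - (n%:R * d) <= sdist k g.
    pose S : R := \sum_(k : sindex D) `|sdist k g|.
    exists (Num.bound (S / d)) => k.
    have : S / d < (Num.bound (S / d))%:R.
      by apply: archi_boundP; rewrite divr_ge0 ?sumr_ge0 // ltW.
    rewrite ltr_pdivrMr // => /ltW le; rewrite lerNl; apply: le_trans le.
    rewrite /S (bigD1 k) //= -[leLHS]addr0 lerD ?sumr_ge0 //.
    by rewrite -normrN ler_norm.
  exact: reach nP.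
elim: n h => [|n IH] h hP.
  by exists 1%g => // k; rewrite mul1g; have := hP k; rewrite mul0r oppr0.
have [fh|/existsNP[k /negP]] := pselect (fdom h).
  by exists 1%g => // k; rewrite mul1g.
rewrite -ltNge => k_lt0.
(* The distance to [opp k] becomes positive; for any other [l] the gap gives at least
   [d + sdist k h], hence at least [- (n%:R * d)]. *)
have [|c Gc fc] := IH (letter k * h)%g; last first.
  exists (c * letter k)%g; last by rewrite -mulgA.
  by apply: GM => //; exact: letter_group.
move=> l; have hk := hP k; rewrite -natr1 mulrDl mul1r in hk.
have [->|lk] := eqVneq l (opp k).
  rewrite sdist_letter; apply: (@le_trans _ _ 0); last by rewrite oppr_ge0 ltW.
  by rewrite oppr_le0 mulr_ge0 // ltW.
have := gap _ _ lk (letter k * h)%g; rewrite sdist_letter; lra.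
Qed.

Definition crossing k g : Prop := sdist k g = 0 /\ 0 < endform k 0 g.

(** Both points lie in the fundamental domain, so a nontrivial [c] is a letter [m]. The gap forces
    [m = k] and [l = opp m], but then the pairing reverses the sign of the endpoint form and the
    geodesic points the wrong way. *)
Lemma crossing_unique k l c g : Gam c ->
  crossing k g -> crossing l (c * g)%g -> c = 1%g.
Proof.
have [d d_gt0 gap] := sdist_gap D.
move=> Gc [kg k_out] [lcg l_out]; have fg := fdom_side kg.
have fcg := fdom_side lcg.
case: (tile_cases Gc fg) => [//|[m cm]|[m lt0]]; last first.
  by have := fcg m; rewrite leNgt lt0.
have mg : sdist m g = 0.
  apply/eqP; rewrite eq_le fg andbT.
  by have := fcg (opp m); rewrite cm sdist_letter oppr_ge0.
have mk : m = k.
  apply/eqP/negPn/negP => /gap/(_ g); rewrite mg kg; lra.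
have lm : l = opp m.
  apply/eqP/negPn/negP => /gap/(_ (c * g)%g).
  rewrite lcg cm sdist_letter mg; lra.
by move: l_out; rewrite cm lm endform_letter mk oppr_gt0 ltNge ltW.
Qed.

(** Closer than [d] to the side [k], the gap keeps the point off all other sides. For [t > 0] it is
    interior to the domain, for [t < 0] interior to the tile across [k], and no translate of an
    interior point lies on a side. *)
Lemma crossing_isolated k : exists2 d, 0 < d & forall g l c t,
  crossing k g -> Gam c -> `|sdist k (g * a_ t)%g| < d -> t != 0 ->
  ~ crossing l (c * (g * a_ t))%g.
Proof.
have [d d_gt0 gap] := sdist_gap D; exists d => //.
have [_ GM GV] := subgroupP (schottky_group D).
move=> g l c t [kg k_out] Gc; set h := (g * a_ t)%g => near0 t0 [lch _].
have /andP[hgt hlt] : (- d < sdist k h) && (sdist k h < d).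
  by rewrite -ltr_norml.
have fch := fdom_side lch.
have others m : m != k -> 0 < sdist m h by move=> /gap/(_ h); lra.
(* On the side the two endpoint terms cancel, so the distance along the flow is a positive multiple
   of sinh t. *)
have kh : sdist k h = (expR t - expR (- t)) * endform k 0 g.
  rewrite sdist_a; move: kg; rewrite /sdist => /eqP.
  by rewrite addr_eq0 => /eqP->; ring.
have [t_lt0|t_gt0|//] := ltgtP t 0; last 1 first.
- by move/eqP: t0.
- have k_lt0 : sdist k h < 0.
    by rewrite kh pmulr_llt0 // subr_lt0 ltr_expR; lra.
  have eh_gt0 m : 0 < sdist m (letter k * h)%g.
    have [->|mk] := eqVneq m (opp k); first by rewrite sdist_letter oppr_gt0.
    by have := gap _ _ mk (letter k * h)%g; rewrite sdist_letter; lra.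
  have c1 : (c * (letter k)^-1)%g = 1%g.
    apply: fdom_interior eh_gt0 _; last by rewrite mulgA mulgVK.
    by apply: GM => //; apply: GV; exact: letter_group.
  have := eh_gt0 l; rewrite -[X in sdist l X]mul1g -c1 mulgA mulgVK lch; lra.
- have h_gt0 m : 0 < sdist m h.
    have [->|/others//] := eqVneq m k.
    by rewrite kh mulr_gt0 // subr_gt0 ltr_expR; lra.
  have c1 : c = 1%g by apply: fdom_interior h_gt0 fch.
  by have := h_gt0 l; rewrite -[h]mul1g -c1 lch ltxx.
Qed.

End Words.

(** * Continuity of the action and of the distances *)

Section Continuity.
Variable R : realType.

Lemma continuous_val_hplane : continuous (val : hplane R -> R[i]^o).
Proof. exact: initial_continuous. Qed.

Lemma continuous_Re : continuous (fun z : R[i]^o => complex.Re z : R).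
Proof.
move=> z; apply/(@cvgrPdist_lt _ R^o (R[i]^o) (nbhs z)) => e e_gt0.
have e_gt0' : 0 < e%:C by rewrite ltcR.
apply: (@filterS _ (nbhs z) _ (ball (z : R[i]^o) e%:C)) => [w|]; last first.
  exact: nbhsx_ballx.
rewrite -ball_normE /= normc_def ltcR.
apply: le_lt_trans; rewrite -[in leLHS]sqrtr_sqr ler_wsqrtr //.
by case: z w => [a b] [a' b'] /=; rewrite lerDl sqr_ge0.
Qed.

Lemma continuous_Im : continuous (fun z : R[i]^o => complex.Im z : R).
Proof.
move=> z; apply/(@cvgrPdist_lt _ R^o (R[i]^o) (nbhs z)) => e e_gt0.
have e_gt0' : 0 < e%:C by rewrite ltcR.
apply: (@filterS _ (nbhs z) _ (ball (z : R[i]^o) e%:C)) => [w|]; last first.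
  exact: nbhsx_ballx.
rewrite -ball_normE /= normc_def ltcR.
apply: le_lt_trans; rewrite -[in leLHS]sqrtr_sqr ler_wsqrtr //.
by case: z w => [a b] [a' b'] /=; rewrite lerDr sqr_ge0.
Qed.

Lemma continuous_Re_hplane :
  continuous (fun z : hplane R => complex.Re (val z)).
Proof.
move=> z; apply: (@continuous_comp _ _ _ (val : hplane R -> R[i]^o)).
  exact: continuous_val_hplane.
exact: continuous_Re.
Qed.

Lemma continuous_Im_hplane :
  continuous (fun z : hplane R => complex.Im (val z)).
Proof.
move=> z; apply: (@continuous_comp _ _ _ (val : hplane R -> R[i]^o)).
  exact: continuous_val_hplane.
exact: continuous_Im.
Qed.

Lemma cvg_hdist_expr (T : Type) (F : set_system T) {FF : Filter F}
    (x y : T -> R) (a b c rho : R) : 0 < rho -> 0 < b ->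
  x t @[t --> F] --> a -> y t @[t --> F] --> b ->
  ((x t - c) ^+ 2 + y t ^+ 2 - rho ^+ 2) / (2 * rho * y t) @[t --> F]
    --> ((a - c) ^+ 2 + b ^+ 2 - rho ^+ 2) / (2 * rho * b).
Proof.
move=> rho_gt0 b_gt0 cx cy.
apply: (@cvgM R).
  apply: (@cvgB R R^o); last exact: cvg_cst.
  have cB : x t - c @[t --> F] --> a - c.
    by apply: (@cvgB R R^o) => //; exact: cvg_cst.
  by apply: (@cvgD R R^o); rewrite expr2; apply: (@cvgM R).
apply: cvgV; first by rewrite gt_eqF // !mulr_gt0.
by apply: (@cvgM R) => //; exact: cvg_cst.
Qed.

Lemma continuous_hdist (D : schottky_data R) (k : sindex D) :
  continuous (hdist k : hplane R -> R).
Proof.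
move=> z; apply: (@cvg_hdist_expr _ (nbhs z) (nbhs_filter z)).
- exact: radius_gt0.
- exact: (valP z).
- exact: continuous_Re_hplane.
- exact: continuous_Im_hplane.
Qed.

Lemma cvg_homography (K : numFieldType) (T : Type) (F : set_system T)
    {FF : Filter F} (x : T -> K) (z a b c d : K) : c * z + d != 0 ->
  x t @[t --> F] --> z ->
  (a * x t + b) / (c * x t + d) @[t --> F] --> (a * z + b) / (c * z + d).
Proof.
move=> nz cx; apply: cvgM.
  apply: (@cvgD K K^o); last exact: cvg_cst.
  by apply: cvgM => //; exact: cvg_cst.
apply: cvgV => //; apply: (@cvgD K K^o); last exact: cvg_cst.
by apply: cvgM => //; exact: cvg_cst.
Qed.

Lemma continuous_hplane_act (g : PSL2 R) : continuous (hplane_act g).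
Proof.
apply: continuous_comp_initial => z.
apply: (@cvg_homography R[i] _ (nbhs z) (nbhs_filter z) (fun w => val w)).
  exact: den_neq0.
exact: continuous_val_hplane.
Qed.

Lemma continuous_entry (i j : 'I_2) : continuous (fun M : SL2 R => val M i j).
Proof.
move=> M; apply: (@continuous_comp _ _ _ (val : SL2 R -> 'M[R]_2)
  (fun A : 'M[R]_2 => A i j)).
  exact: initial_continuous.
exact: coord_continuous.
Qed.

Lemma cvg_qform (T : Type) (F : set_system T) {FF : Filter F}
    (x y : T -> R) (a b c rho : R) :
  x t @[t --> F] --> a -> y t @[t --> F] --> b ->
  qform c rho (x t) (y t) @[t --> F] --> qform c rho a b.
Proof.
move=> cx cy; apply: (@cvgM R); last exact: cvg_cst.
have cM (p : R) (z : T -> R) (l : R) : z t @[t --> F] --> l ->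
    p * z t @[t --> F] --> p * l.
  by move=> cz; apply: (@cvgM R) => //; exact: cvg_cst.
have cB : x t - c * y t @[t --> F] --> a - c * b.
  by apply: (@cvgB R R^o) => //; exact: cM.
by apply: (@cvgB R R^o); rewrite expr2; apply: (@cvgM R) => //; exact: cM.
Qed.

(** By the quotient topology it suffices to compose with the projection from [SL2], where the
    function is polynomial in the entries. *)
Lemma continuous_sdist (D : schottky_data R) (k : sindex D) (h : PSL2 R) :
  continuous (fun g => sdist k (h * g)%g : R).
Proof.
apply/quotient_continuous => M.
pose A := val (repr h).
have -> : (fun g => sdist k (h * g)%g) \o \pi_(PSL2 R) = (fun N : SL2 R =>
    qform (scenter k) (sradius k)
      (A 0 0 * val N 0 0 + A 0 1 * val N 1 0)
      (A 1 0 * val N 0 0 + A 1 1 * val N 1 0)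
  + qform (scenter k) (sradius k)
      (A 0 0 * val N 0 1 + A 0 1 * val N 1 1)
      (A 1 0 * val N 0 1 + A 1 1 * val N 1 1)).
  apply/funext => N /=; rewrite /sdist -[in LHS](reprK h).
  by rewrite -[(_ * _)%g]/(PSL2_mul _ _) PSL2_mul_pi !endform_pi /= !mul2E.
have FF := nbhs_filter M.
have cE (i j : 'I_2) (p : R) :
    p * val (N : SL2 R) i j @[N --> M] --> p * val (M : SL2 R) i j.
  by apply: (@cvgM R _ (nbhs M) FF); [exact: cvg_cst|exact: continuous_entry].
have cD (i j i' j' : 'I_2) (p p' : R) :
    p * val (N : SL2 R) i j + p' * val (N : SL2 R) i' j' @[N --> M]
      --> p * val (M : SL2 R) i j + p' * val (M : SL2 R) i' j'.
  by apply: (@cvgD R R^o _ (nbhs M) FF); exact: cE.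
by apply: (@cvgD R R^o _ (nbhs M) FF); apply: (@cvg_qform _ (nbhs M) FF);
  exact: cD.
Qed.

End Continuity.

(** * Geodesics and recurrence in one factor *)

Section Geodesics.
Variable R : realType.
Implicit Types (g h c : PSL2 R) (z w : hplane R) (s t : R).

Lemma Im_a t : complex.Im (val (hplane_act (a_ t) (hplane_i R))) = expR t.
Proof.
rewrite hplane_act_i /= /a_mx !mxE /= !mulr1n !mulr0n expr0n add0r.
by rewrite -expRM_natl -expRN; congr expR; field.
Qed.

Lemma hplane_act_trans z : exists g, hplane_act g (hplane_i R) = z.
Proof.
case: z => -[x y] y_gt0; have y0 : 0 < y by [].
pose u := Num.sqrt y; have u_gt0 : 0 < u by rewrite sqrtr_gt0.
have u2 : u ^+ 2 = y by rewrite sqr_sqrtr // ltW.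
(* The map z -> y z + x, normalized to determinant 1. *)
pose A : 'M[R]_2 := \matrix_(i, j)
  if i == 0 then if j == 0 then u else x / u else if j == 0 then 0 else u^-1.
have dA : \det A == 1.
  rewrite -det_tr det_trig; last first.
    by apply/is_trig_mxP => -[[|[|//]] ?] [[|[|//]] ?] //= _; rewrite !mxE.
  by rewrite !big_ord_recl big_ord0 !mxE /= mulr1 mulfV // gt_eqF.
exists (\pi_(PSL2 R) (exist _ A dA)); apply: val_inj.
rewrite hplane_act_i /= !mxE /= expr0n add0r mulr0 add0r -u2.
apply/eqP; rewrite eq_complex /=; apply/andP; split; apply/eqP.
  by field; rewrite gt_eqF.
by rewrite exprVn invrK.
Qed.

Lemma a_D s t : (a_ s * a_ t)%g = a_ (s + t) :> PSL2 R.
Proof.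
rewrite -[(_ * _)%g]/(PSL2_mul _ _) PSL2_mul_pi; congr (\pi_(PSL2 R) _).
apply: val_inj; rewrite /= /a_mx mulmx_diag; congr diag_mx.
apply/rowP => i; rewrite !mxE -expRD; congr expR.
by case: ifP => _; rewrite mulrDl // opprD.
Qed.

Lemma a_0 : a_ 0 = 1%g :> PSL2 R.
Proof.
congr (\pi_(PSL2 R) _); apply: val_inj; rewrite /= /a_mx.
apply/matrixP => i j; rewrite !mxE mul0r oppr0 if_same expR0.
by case: eqVneq.
Qed.

Variable D : schottky_data R.
Local Notation Gam := (subgroup_set (schottky_group D)).

(* A side entered by the geodesic through [g] is left, after applying its side
   pairing, by the translated geodesic through the paired side. *)
Lemma entering_crossing (k : sindex D) g t : 0 <= t -> 0 <= sdist k g ->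
  sdist k (g * a_ t)%g < 0 ->
  exists s, crossing (opp k) (letter k * (g * a_ s))%g.
Proof.
move=> t_ge0; rewrite sdist_a /sdist.
set al := endform k 0 g; set be := endform k 1 g => ge0 lt0.
have eN : expR (- t) <= expR t by rewrite ler_expR; lra.
have al_lt0 : al < 0.
  rewrite ltNge; apply/negP => al_ge0; move: lt0; rewrite ltNge => /negP; apply.
  apply: (@le_trans _ _ (expR (- t) * (al + be))).
    by rewrite mulr_ge0 // expR_ge0.
  by rewrite mulrDr lerD2r ler_wpM2r.
have q_gt0 : 0 < - be / al.
  by rewrite mulNr -mulrN -invrN divr_gt0 //; lra.
(* The time at which [expR s * al + expR (- s) * be] vanishes. *)
pose s := ln (- be / al) / 2; exists s; split.
  have es : expR s * expR s = - be / al.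
    by rewrite -expRD -splitr lnK.
  rewrite sdist_letter sdist_a -/al -/be; apply/eqP; rewrite oppr_eq0.
  have : expR s * (expR s * al + expR (- s) * be) = 0.
    rewrite mulrDr (mulrA _ _ al) (mulrA _ _ be) es.
    rewrite -expRD subrr expR0 mul1r divfK ?lt_eqF //.
    by rewrite addNr.
  by move/eqP; rewrite mulf_eq0 gt_eqF ?expR_gt0.
rewrite endform_letter endform_a0 -/al oppr_gt0 pmulr_rlt0 //.
exact: expR_gt0.
Qed.

Lemma hdist_act (k : sindex D) g h :
  hdist k (hplane_act g (hplane_act h (hplane_i R))) = sdist k (g * h)%g.
Proof. by rewrite -hplane_actM hdist_i. Qed.

Lemma recurrent_crossing g w :
  (forall B, nbhs w B -> forall t0, exists2 t, t0 < t &
     exists2 c, Gam c & B (hplane_act (c * (g * a_ t))%g (hplane_i R))) ->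
  exists c t (k : sindex D), Gam c /\ crossing k (c * (g * a_ t))%g.
Proof.
move=> rec; apply: contrapT => nocross.
have [d d_gt0 gap] := sdist_gap D.
have [_ GM GV] := subgroupP (schottky_group D).
have [c1 Gc1 fg1] := fdom_reach D g; set g1 := (c1 * g)%g in fg1.
(* Leaving the domain means entering a disk, and [entering_crossing] would then produce a
   crossing. *)
have stay t : 0 <= t -> fdom D (g1 * a_ t)%g.
  move=> t_ge0 k; rewrite leNgt; apply/negP => lt0.
  have [s cr] := entering_crossing t_ge0 (fg1 k) lt0.
  apply: nocross; exists (letter k * c1)%g, s, (opp k); split.
    by apply: GM => //; exact: letter_group.
  by rewrite -!mulgA in cr *.
have [n nw] := hplane_act_trans w.
have [c0 Gc0 fn] := fdom_reach D n.
(* Distinct sides do not meet, so the chosen point over [w] lies on at most one side [k]; if it lies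
   on none, any [k] serves. *)
have [k kP] : exists k : sindex D, forall l, l != k -> 0 < sdist l (c0 * n)%g.
  have [[k k0]|nz] := pselect (exists k : sindex D, sdist k (c0 * n)%g = 0).
    by exists k => l /gap/(_ (c0 * n)%g); rewrite k0; lra.
  exists (Ordinal (srank_gt0 D), true) => l _.
  by rewrite lt_def fn andbT; apply/eqP => l0; apply: nz; exists l.
pose Y c z := complex.Im (val (hplane_act c z)).
have cY c z : Y c x @[x --> z] --> Y c z.
  apply: (@continuous_comp _ _ R (hplane_act c) (fun y => complex.Im (val y))).
    exact: continuous_hplane_act.
  exact: continuous_Im_hplane.
have cS c (l : sindex D) z :
    hdist l (hplane_act c x) @[x --> z] --> hdist l (hplane_act c z).
  apply: (@continuous_comp _ _ R (hplane_act c) (hdist l)).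
    exact: continuous_hplane_act.
  exact: continuous_hdist.
have Y_gt0 c z : 0 < Y c z by exact: (valP (hplane_act c z)).
(* For the element [b] introduced below, [ca] takes the visited point to height [expR t] when
   [b = 1], and [cb] does so when [letter k * b = 1]. *)
pose ca := (g1^-1 * c0)%g; pose cb := (g1^-1 * (letter k * c0))%g.
pose T := 1 + Y ca w + Y cb w.
pose B := [set z | [/\ Y ca z < T, Y cb z < T
  & forall l, (if l == k then - d else 0) < hdist l (hplane_act c0 z)]].
(* A visit to [B] at a time [t > T] happens in the fundamental domain or across
   the side [k]; pulling back by [g1^-1] the visited point has height [expR t],
   which the first two conditions of [B] exclude. *)
have nB : nbhs w B.
  have Fw := nbhs_filter w.
  have nl : \forall z \near w, forall l : sindex D,
      (if l == k then - d else 0) < hdist l (hplane_act c0 z).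
    apply: (@filter_forall _ _ _ (nbhs w) Fw) => l.
    apply: (@cvgr_gt R _ (nbhs w) Fw _ _ (cS c0 l w)).
    rewrite -nw hdist_act; case: eqVneq => [->|/kP//].
    by apply: lt_le_trans (fn k); rewrite oppr_lt0.
  have na : \forall z \near w, Y ca z < T.
    apply: (@cvgr_lt R _ (nbhs w) Fw _ _ (cY ca w)).
    by have := Y_gt0 cb w; rewrite /T; lra.
  have nb : \forall z \near w, Y cb z < T.
    apply: (@cvgr_lt R _ (nbhs w) Fw _ _ (cY cb w)).
    by have := Y_gt0 ca w; rewrite /T; lra.
  apply: (@filterS3 _ (nbhs w) Fw _ _ _ _ _ na nb nl) => z za zb zl.
  by split.
have [t tT [c Gc [ltA ltB ltS]]] := rec B nB T.
have t_ge0 : 0 <= t.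
  by have := Y_gt0 ca w; have := Y_gt0 cb w; move: tT; rewrite /T; lra.
have far : T < expR t by have := expR_ge1Dx t; lra.
set z := (g1 * a_ t)%g; pose b := (c0 * c * c1^-1)%g.
have fz : fdom D z by exact: stay.
have Gb : Gam b by apply: (GM); [exact: GM|exact: GV].
have bz : (c0 * (c * (g * a_ t)))%g = (b * z)%g.
  by rewrite /b /z /g1 -!mulgA mulKg.
have not_id : b <> 1%g.
  move=> b1; move: ltA; rewrite /Y -hplane_actM /ca -mulgA bz b1 mul1g.
  by rewrite /z mulKg Im_a => ltA; lra.
have not_letter : (letter k * b)%g <> 1%g.
  move=> b1; move: ltB; rewrite /Y -hplane_actM /cb -!mulgA bz.
  rewrite [(letter k * (b * z))%g]mulgA b1 mul1g.
  by rewrite /z mulKg Im_a => ltB; lra.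
have {}ltS (l : sindex D) : (if l == k then - d else 0) < sdist l (b * z)%g.
  by have := ltS l; rewrite hdist_act bz.
(* A letter [m] puts the point in the closed disk [opp m], which [B] allows only for [opp m = k]. *)
case: (tile_cases Gb fz) => [//|[m bm]|[m lt0]].
  have := fz m; rewrite -oppr_le0 -sdist_letter -bm => le0.
  have mk : opp m = k.
    by have := ltS (opp m); case: eqVneq => // _; rewrite ltNge le0.
  by apply: not_letter; rewrite bm -mk letter_opp mulVg.
(* Here the distance to the side [k] lies between [- d] and 0, so [letter k] takes the point into
   the interior of the domain and [fdom_interior] gives [letter k * b = 1]. *)
have mk : m = k by have := ltS m; case: eqVneq => // _; rewrite ltNge ltW.
rewrite {}mk in lt0; have := ltS k; rewrite eqxx => gtk.
have y_gt0 (l : sindex D) : 0 < sdist l (letter k * (b * z))%g.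
  have [->|lk] := eqVneq l (opp k); first by rewrite sdist_letter oppr_gt0.
  by have := gap _ _ lk (letter k * (b * z))%g; rewrite sdist_letter; lra.
apply: not_letter; apply: (can_inj (@invgK _)); rewrite invg1.
apply: (fdom_interior _ y_gt0); last first.
  by rewrite [(letter k * (b * z))%g]mulgA mulKg.
by apply: GV; apply: (GM) => //; exact: letter_group.
Qed.

End Geodesics.

(** * Flats and recurrence in the quotient *)

Section Flats.
Variables (R : realType) (r : nat) (Gam : subgroup (PSL2r R r)).

Lemma groupA_cst0 (j : 'I_r) (t : R) :
  groupA (fun i => a_ (if i == j then t else 0) : PSL2 R).
Proof. by exists (fun i => if i == j then t else 0). Qed.

Lemma groupAM (a b : PSL2r R r) : groupA a -> groupA b -> groupA (a * b)%g.
Proof.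
move=> [s aE] [t bE]; exists (fun j => s j + t j) => j.
by rewrite -a_D -aE -bE.
Qed.

Lemma groupAV (a : PSL2r R r) : groupA a -> groupA a^-1%g.
Proof.
move=> [t aE]; exists (fun j => - t j) => j.
rewrite -[LHS]/((a j)^-1)%g aE; apply: (can_inj (@invgK _)); rewrite invgK.
rewrite -[LHS]mulg1 -[X in (_ * X)%g](mulgV (a_ (- t j))) mulgA.
by rewrite a_D subrr a_0 mul1g.
Qed.

Lemma flowM (x : quotG Gam) (a b : PSL2r R r) :
  flow (flow x a) b = flow x (a * b)%g.
Proof. by rewrite {1}/flow -/(flow _ _) flow_pi -mulgA. Qed.

Lemma flat_of_flow (x : quotG Gam) (a : PSL2r R r) : groupA a ->
  flat_of (flow x a) = flat_of x.
Proof.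
move=> Aa; apply/seteqP; split=> _ [b Ab <-].
  by exists (a * b)%g; [exact: groupAM|rewrite flowM].
exists (a^-1 * b)%g; first by apply: groupAM => //; exact: groupAV.
by rewrite flowM mulgA mulgV mul1g.
Qed.

(** The set is the image of a union of open sets that is invariant under the group, hence saturated.
    It provides neighborhoods in the quotient that constrain only the factor [j]. *)
Lemma open_spaceY_translates (j : 'I_r) (B : set (hplane R)) : open B ->
  open [set y : spaceY Gam | exists2 x, \pi_(spaceY Gam) x = y &
    exists2 c, subgroup_set Gam c & B (hplane_act (c j) (x j))].
Proof.
move=> oB; set V := (X in open X).
have {V}-> : V = \pi_(spaceY Gam) @` \bigcup_(c in subgroup_set Gam)
    (fun x : spaceX R r => hplane_act (c j) (x j)) @^-1` B.
  apply/seteqP; split=> y.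
    by move=> [x xy [c Gc Bc]]; exists x => //; exists c.
  by move=> [x [c Gc Bc] xy]; exists x => //; exists c.
set U := \bigcup_(_ in _) _.
suff piU : \pi_(spaceY Gam) @^-1` (\pi_(spaceY Gam) @` U) = U.
  rewrite /open /= /quotient_open piU.
  apply: bigcup_open => c _; apply: open_comp => // x _.
  apply: (@continuous_comp _ _ _ (fun x : spaceX R r => x j)
    (hplane_act (c j))).
    exact: (@proj_continuous _ _ j).
  exact: continuous_hplane_act.
have [_ GM GV] := subgroupP Gam.
apply/seteqP; split=> [x [x' [c Gc Bc]]|x Ux]; last by exists x.
move/(orbit_spaceP (X_laction R r)) => [e Ge ->].
exists (c * e^-1)%g; first by apply: GM => //; exact: GV.
rewrite /= /X_act -hplane_actM.
have -> : (c * e^-1 : PSL2r R r)%g j = (c j * (e j)^-1)%g by [].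
by rewrite mulgVK.
Qed.

(** Moving only the factor [j] stays in the compact flat, so the footpoints cluster somewhere as the
    time tends to +oo; [w] is the [j]-th coordinate of a lift of a cluster point. *)
Lemma compact_flat_recurrent (x : quotG Gam) (j : 'I_r) :
  compact_flat (flat_of x) ->
  exists w : hplane R, forall B, nbhs w B -> forall t0 : R,
    exists2 t, t0 < t & exists2 c, subgroup_set Gam c &
      B (hplane_act (c j * (repr x j * a_ t))%g (hplane_i R)).
Proof.
move=> cpt; have [G1 GM _] := subgroupP Gam.
pose a t : PSL2r R r := fun i => a_ (if i == j then t else 0).
pose p t : spaceY Gam := footpoint (flow x (a t)).
have [|y [_ cl]] := cpt (p @ +oo).
  apply: (@filterS _ (+oo : set_system R) _ setT) => [t _|];
    last exact: filterT.
  by exists (flow x (a t)) => //; exists (a t) => //; exact: groupA_cst0.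
exists (repr y j) => B nB t0.
pose V : set (spaceY Gam) := [set y' : spaceY Gam |
   exists2 x, \pi_(spaceY Gam) x = y' & exists2 c, subgroup_set Gam c
    & B^° (hplane_act (c j) (x j))].
have nV : nbhs y V.
  apply: open_nbhs_nbhs; split.
    by apply: open_spaceY_translates; exact: open_interior.
  exists (repr y); first exact: reprK.
  exists 1%g => //; rewrite hplane_act1.
  by apply: nbhs_singleton; apply: nbhs_interior.
have [|z [[t t0t <-] [x' x'E [c Gc Bc]]]] := cl (p @` [set t | t0 < t]) V _ nV.
  have : \forall t \near +oo, t0 < t by exact: (nbhs_pinfty_gt (num_real t0)).
  by apply: (@filterS _ (+oo : set_system R)) => t t0t; exists t.
exists t => //.
have [e Ge x'e] : exists2 e, subgroup_set Gam e &
    x' = X_act e (X_act (repr x * a t)%g (@origin R r)).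
  apply/(orbit_spaceP (X_laction R r)).
  by rewrite -/(spaceY Gam) x'E /p /flow footpoint_pi.
exists (c * e)%g; first exact: GM.
have := interior_subset Bc; rewrite x'e /X_act -!hplane_actM.
have -> : (repr x * a t : PSL2r R r)%g j = (repr x j * a_ t)%g.
  by rewrite -[LHS]/(repr x j * a t j)%g /a eqxx.
have -> : (c * e : PSL2r R r)%g j = (c j * e j)%g by [].
by rewrite mulgA.
Qed.

End Flats.

(** * The cross section for the product group *)

Section SchottkyProducts.
Variables (R : realType) (r : nat) (D : 'I_r -> schottky_data R).

Lemma Cm_crossing (m : forall j, sindex (D j)) (g : PSL2r R r) :
  Cm m g <-> forall j, crossing (m j) (g j).
Proof.
split=> mg j; have [h1 h2] := mg j.
  by split; [rewrite -hdist_i; exact/sideE|exact/forwardE].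
by split; [apply/sideE; rewrite hdist_i|exact/forwardE].
Qed.

(** Crossings are found in each factor separately, and their group elements and times combine
    because both the group and [groupA] are full products. *)
Lemma compact_flat_meets_Chat (x : quotG (schottky_product D)) :
  compact_flat (flat_of x) ->
  exists y, intersects_in (flat_of x) (Chat D) y.
Proof.
move=> cpt; pose g := repr x.
have cr j : exists q : PSL2 R * R * sindex (D j),
    subgroup_set (schottky_group (D j)) q.1.1 /\
    crossing q.2 (q.1.1 * (g j * a_ q.1.2))%g.
  have [w rec] := compact_flat_recurrent j cpt.
  have [|c [t [k [Gc ck]]]] := @recurrent_crossing R (D j) (g j) w.
    move=> B nB t0; have [t t0t [c Gc Bc]] := rec B nB t0.
    by exists t => //; exists (c j); [exact: Gc|].
  by exists (c, t, k).
pose q j := projT1 (cid (cr j)).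
pose c : PSL2r R r := fun j => (q j).1.1.
pose a : PSL2r R r := fun j => a_ (q j).1.2.
have qP j : subgroup_set (schottky_group (D j)) (c j) /\
    crossing (q j).2 (c j * (g j * a j))%g := projT2 (cid (cr j)).
have Aa : groupA a by exists (fun j => (q j).1.2).
have xa : piGam (schottky_product D) (c * (g * a))%g = flow x a.
  by apply/esym/piGamP; exists c => // j; exact: (qP j).1.
exists (flow x a); split; last exact: flat_of_flow.
rewrite -xa; exists (c * (g * a))%g => //; exists (fun j => (q j).2) => //.
by apply/Cm_crossing => j; exact: (qP j).2.
Qed.

Lemma near1_sdist (j : 'I_r) (k : sindex (D j)) (g : PSL2 R) (d : R) :
  0 < d -> sdist k g = 0 ->
  \forall a \near (1%g : PSL2r R r), `|sdist k (g * a j)%g| < d.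
Proof.
move=> d_gt0 kg; have F1 := nbhs_filter (1%g : PSL2r R r).
have cvg0 : sdist k (g * a j)%g @[a --> (1%g : PSL2r R r)] --> (0 : R).
  rewrite -kg -[in X in _ --> X](mulg1 g).
  apply: (@continuous_comp _ _ R (fun a : PSL2r R r => a j)
    (fun h => sdist k (g * h)%g)).
    exact: (@proj_continuous _ _ j).
  exact: continuous_sdist.
have lt := @cvgr_lt R _ _ F1 _ _ cvg0 d d_gt0.
have gt : \forall a \near (1%g : PSL2r R r), - d < sdist k (g * a j)%g.
  by apply: (@cvgr_gt R _ _ F1 _ _ cvg0); rewrite oppr_lt0.
apply: (@filterS2 _ (nbhs (1%g : PSL2r R r)) F1 _ _ _ _ lt gt) => a lta gta.
by rewrite ltr_norml gta lta.
Qed.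

(* Regular elements move every factor, so isolating the crossing in one factor
   is enough. *)
Lemma Chat_discrete (x : quotG (schottky_product D)) :
  (0 < r)%N -> Chat D x -> discrete_intersection (Chat D) x.
Proof.
move=> r_gt0 [h [m _ /Cm_crossing hm] <-].
(* Positivity of [r] supplies a factor that every regular element moves. *)
pose j := Ordinal r_gt0; have [d d_gt0 iso] := crossing_isolated (m j).
pose V : set (PSL2r R r) := [set a | `|sdist (m j) (h j * a j)%g| < d].
exists (@groupA R r `&` V); split=> [a []//| |a [[_ Va] [t [t0 aE]]]].
  have := near1_sdist d_gt0 (hm j).1.
  by apply: (@filterS _ (nbhs (1%g : PSL2r R r))) => a Va Aa; split.
rewrite flow_pi => -[h' [n _ /Cm_crossing hn]].
move/esym/piGamP => [c Gc h'E].
move: Va; rewrite /V /= aE => Va.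
apply: (iso (h j) (n j) (c j) (t j) (hm j) (Gc j) Va (t0 j)).
by have := hn j; rewrite h'E -aE.
Qed.

(** Injectivity is [crossing_unique] in each factor. *)
Lemma Crep_representatives : set_of_representatives (Crep D) (Chat D).
Proof.
split=> [h Ch|h h'|//]; first by exists h.
move=> /set_mem[m _ /Cm_crossing hm] /set_mem[n _ /Cm_crossing hn].
move/piGamP => [c Gc h'E]; rewrite h'E; apply/funext => j.
have := hn j; rewrite h'E => /(crossing_unique (Gc j) (hm j)) c1.
by rewrite -[RHS]/(c j * h j)%g c1 mul1g.
Qed.

End SchottkyProducts.

Theorem theorem4p1 (R : realType) (r : nat) (r_gt0 : (0 < r)%N)
    (D : 'I_r -> schottky_data R) :
  cross_section (Chat D) /\ set_of_representatives (Crep D) (Chat D).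
Proof.
split; last exact: Crep_representatives.
split=> [_ [x ->]|F x _ [Cx _]]; first exact: compact_flat_meets_Chat.
exact: Chat_discrete.
Qed.
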